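(* An element $a=(a_1,a_2,\dots)\in X$ belongs to the center set $\mathcal{C}$ if and only if there is a sequence $u_1,u_2,\dots$ of $2\pi$-periodic Lipschitz functions such that $u_i(0)=0$ for any $i$ and $$\sum_{i=1}^{\infty}a_i(x)t^{i+1}=-\frac{\sum_{k=1}^{\infty}u_k'(x)t^{k+1}}{1+\sum_{k=1}^{\infty}(k+1)u_k(x)t^{k}}$$ as formal power series in $t$.
   Context: Functions on the circle $S^1$ are identified with $2\pi$-periodic functions on $\mathbb{R}$. $X$ is the complex vector space of sequences $a=(a_1,a_2,\dots)$ with $a_i\in L^\infty(S^1)$ (complex-valued) for which there is $l>0$ (depending on $a$) with $\sup_{x\in S^1}|a_i(x)|\le l^i$ for all $i\ge1$ (sup understood as the $L^\infty$-norm). For $a\in X$ and sufficiently small $r$ there is a unique Lipschitz function $v(x;r;a)$, $x\in[0,2\pi]$, satisfying $\frac{dv}{dx}=\sum_{i\ge1}a_i(x)v^{i+1}$ almost everywhere and $v(0;r;a)=r$. The equation determines a center if $v(2\pi;r;a)=r$ for all sufficiently small $r$; $\mathcal{C}\subset X$ is the set of $a\in X$ whose equation determines a center. The functions $u_k$ are complex-valued; the derivatives $u_k'$ exist almost everywhere and define elements of $L^\infty(S^1)$, and the identity of formal power series means that the coefficients of each power of $t$ agree as elements of $L^\infty(S^1)$ (i.e. for almost every $x$). *)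

(* Defs.v *)
From HB Require Import structures.
From mathcomp Require Import all_boot all_order all_algebra.
From mathcomp Require Import complex.
From mathcomp Require Import all_classical all_reals all_analysis.

Set Implicit Arguments.
Unset Strict Implicit.
Unset Printing Implicit Defensive.

Import Order.TTheory GRing.Theory Num.Theory.
Import numFieldNormedType.Exports.

Local Open Scope classical_set_scope.
Local Open Scope ring_scope.
Local Open Scope complex_scope.

Section FormalPowerSeries.
Variable F : fieldType.

(* A formal power series over F is its sequence of coefficients nat -> F. *)
Implicit Types f g : nat -> F.

Definition fps_opp f : nat -> F := fun n => - f n.

Definition fps_mul f g : nat -> F :=
  fun n => \sum_(i < n.+1) f i * g (n - i)%N.

(* The first n coefficients of the inverse of g, where g 0 != 0. *)
Fixpoint fps_inv_seq g (n : nat) : seq F :=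
  if n is m.+1 then
    let s := fps_inv_seq g m in
    rcons s ((g 0%N)^-1 * ((m == 0%N)%:R - \sum_(i < m) s`_i * g (m - i)%N))
  else [::].

Definition fps_inv g : nat -> F := fun n => (fps_inv_seq g n.+1)`_n.

Definition fps_div f g : nat -> F := fps_mul f (fps_inv g).

Lemma size_fps_inv_seq g n : size (fps_inv_seq g n) = n.
Proof. by elim: n => //= n IHn; rewrite size_rcons IHn. Qed.

Lemma nth_fps_inv_seq g n i :
  (i < n)%N -> (fps_inv_seq g n)`_i = fps_inv g i.
Proof.
elim: n => // n IHn; rewrite ltnS leq_eqVlt => /orP[/eqP -> //|i_lt_n].
by rewrite /= nth_rcons size_fps_inv_seq i_lt_n IHn.
Qed.

Lemma fps_invE g n : fps_inv g n =
  (g 0%N)^-1 * ((n == 0%N)%:R - \sum_(i < n) fps_inv g i * g (n - i)%N).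
Proof.
rewrite {1}/fps_inv /= nth_rcons size_fps_inv_seq ltnn eqxx.
by congr (_ * (_ - _)); apply: eq_bigr => i _; rewrite nth_fps_inv_seq.
Qed.

Lemma fps_mulVf g n : g 0%N != 0 ->
  fps_mul (fps_inv g) g n = (n == 0%N)%:R.
Proof.
move=> g0; rewrite /fps_mul big_ord_recr /= subnn (fps_invE g n).
by rewrite mulrAC mulVf// mul1r addrC subrK.
Qed.

End FormalPowerSeries.

Section Circle.
Variable R : realType.
Implicit Types (f v : R -> R[i]) (a u : nat -> R -> R[i]).

Local Notation mu := (@lebesgue_measure R).
Local Notation normc := (@Normc.normc R).

(* R[i] carries no topology over R in the library: limits, Lipschitz bounds
   and L^oo norms go through the real-valued modulus normc, and measurability
   and derivatives are taken on real and imaginary parts. *)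

Definition cvgC (s : nat -> R[i]) (l : R[i]) : Prop :=
  (fun n => normc (s n - l)) @ \oo --> (0 : R).

Definition lipschitzC (A : set R) f : Prop :=
  exists K : R, forall x y, A x -> A y -> normc (f x - f y) <= K * `|x - y|.

Definition derivableC f (x : R) : Prop :=
  derivable (fun t => complex.Re (f t)) x 1 /\
  derivable (fun t => complex.Im (f t)) x 1.

(* Meaningful only where derivableC holds, which for a Lipschitz f is almost
   everywhere. *)
Definition deriveC f (x : R) : R[i] :=
  derive1 (fun t => complex.Re (f t)) x +i*
  derive1 (fun t => complex.Im (f t)) x.

Definition Linfty_norm f : \bar R := 'N[mu]_+oo[EFin \o (normc \o f)].

(* Representatives of the elements of L^oo(S^1); by periodicity the essential
   supremum over R is the one over a period. Every Lebesgue class on the circle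
   has a Borel measurable 2pi-periodic representative. *)
Definition in_Linfty_circle f : Prop :=
  [/\ periodic f (pi *+ 2),
      measurable_fun setT (fun x => complex.Re (f x)),
      measurable_fun setT (fun x => complex.Im (f x)) &
      (Linfty_norm f < +oo)%E].

(* Sequences indexed by i >= 1 are shifted: a i stands for a_{i+1} and
   u k for u_{k+1}. *)
Definition in_X a : Prop :=
  (forall i, in_Linfty_circle (a i)) /\
  (exists2 l : R, 0 < l & forall i, (Linfty_norm (a i) <= (l ^+ i.+1)%:E)%E).

(* If in_X a holds and normc r is small, there is exactly one such v up to its
   values outside [0, 2pi]. *)
Definition is_solution a (r : R[i]) v : Prop :=
  [/\ lipschitzC `[0, pi *+ 2] v,
      v 0 = r &
      {ae mu, forall x, x \in `[0, pi *+ 2] -> derivableC v x /\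
        cvgC (fun n => \sum_(i < n) a i x * v x ^+ i.+2) (deriveC v x)}].

Definition in_center_set a : Prop :=
  exists2 e : R, 0 < e & forall r : R[i], normc r < e ->
    exists2 v, is_solution a r v & v (pi *+ 2) = r.

(* sum_{i >= 1} a_i(x) t^{i+1} *)
Definition equation_series a (x : R) : nat -> R[i] :=
  fun n => if n is m.+2 then a m x else 0.

(* sum_{k >= 1} u_k'(x) t^{k+1} *)
Definition numerator_series u (x : R) : nat -> R[i] :=
  fun n => if n is m.+2 then deriveC (u m) x else 0.

(* 1 + sum_{k >= 1} (k+1) u_k(x) t^k *)
Definition denominator_series u (x : R) : nat -> R[i] :=
  fun n => if n is m.+1 then m.+2%:R * u m x else 1.

End Circle.

(* Main.v *)
(* The identity of formal power series says that
   F(t, x) = t + sum_k u_k(x) t^(k+1) is a formal first integral, that is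
   F_x + (sum_i a_i t^(i+1)) F_t = 0; on coefficients,
   u_n' = - (a_n + sum_(k < n) (k+1) u_k a_(n-k)).

   If the u_k are periodic, this recursion bounds (k+1) |u_k| by c^k, so that
   F(v, x) = r has for small r a Lipschitz solution v(x) with v = r where all
   the u_k vanish. Its partial sums F_N(v(x), x) have Lipschitz constants tending
   to 0, and the chain rule turns this into v' = sum_i a_i v^(i+1) almost
   everywhere. Conversely, for a center one integrates the recursion; assuming
   u_k(2 pi) = 0 for k < n, the growth of F_n along the solution starting at r is
   O(|r|^(n+2)) while it equals u_n(2 pi) r^(n+1), hence u_n(2 pi) = 0 and u_n is
   periodic.

   Lipschitz functions are differentiated by applying the Radon-Nikodym theorem
   to the Lebesgue-Stieltjes measure of f + K x and the Lebesgue differentiation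
   theorem to the resulting density. *)

Require Import Defs.
From HB Require Import structures.
From mathcomp Require Import all_boot all_order all_algebra.
From mathcomp Require Import complex.
From mathcomp Require Import all_classical all_reals all_analysis.
From mathcomp Require Import measurable_realfun ess_sup_inf ring lra.

Import Order.TTheory GRing.Theory Num.Theory.
Import numFieldNormedType.Exports.

Local Open Scope classical_set_scope.
Local Open Scope ring_scope.
Local Open Scope complex_scope.

Set Implicit Arguments.
Unset Strict Implicit.
Unset Printing Implicit Defensive.

(** * Lipschitz functions on the real line *)

Section RealLine.
Context {R : realType}.
Notation mu := (@lebesgue_measure R).

(** Only finite sums are differentiated: both series are cut at a common order [N], and the products
    left over form an explicit remainder. It has at most [N ^ 2] monomials, each geometrically
    small, and a bound such as [1/8] on [c |v|] beats their number.

    The recursion alone bounds [u_k] only for [x >= 0], by a geometric ratio that grows with [x];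
    periodicity makes the bound uniform on the line. This dictates the shape of the converse: the
    derivative prescribed for [u_n] is known to be bounded on the whole line only once all earlier
    [u_k] are periodic, so periodicity is established inside the recursion, one index at a time.
    Real initial values tending to 0 suffice for this.

    Derivatives exist only almost everywhere, so the mean value theorem gives way to the fact that a
    Lipschitz function whose derivative is almost everywhere nonpositive does not increase; the
    Lipschitz bound excludes functions of Cantor type. Countably many exceptional null sets are
    merged before a point [x] is fixed. *)

Lemma ae_mono (P Q : R -> Prop) :
  (forall x, P x -> Q x) -> {ae mu, forall x, P x} -> {ae mu, forall x, Q x}.
Proof. by move=> PQ; apply: filterS PQ; exact: (ae_filter_ringOfSetsType mu). Qed.

Lemma ae_mono2 (P Q S : R -> Prop) : (forall x, P x -> Q x -> S x) ->
  {ae mu, forall x, P x} -> {ae mu, forall x, Q x} -> {ae mu, forall x, S x}.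
Proof. by move=> PQ; apply: filterS2 PQ; exact: (ae_filter_ringOfSetsType mu). Qed.

Lemma lebesgue_stieltjes_oc (G : cumulative R R) (x y : R) : x <= y ->
  lebesgue_stieltjes_measure G `]x, y] = (G y - G x)%:E.
Proof.
move=> xy; rewrite /lebesgue_stieltjes_measure /measure_extension.
rewrite measurable_mu_extE/=; last exact: is_ocitv.
by rewrite wlength_itv_bnd.
Qed.

(** As [G + H] is linear, the two Stieltjes measures add up to [K] times Lebesgue measure, by
    uniqueness on half-open intervals. A Lebesgue null set is then null for each of them. *)
Lemma lebesgue_stieltjes_dominated (G H : cumulative R R) (K : R) : 0 < K ->
  (forall x, G x + H x = K * x) -> lebesgue_stieltjes_measure G `<< mu.
Proof.
move=> K0 GH.
pose k := NngNum (ltW K0).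
pose s := measure_add (lebesgue_stieltjes_measure G) (lebesgue_stieltjes_measure H).
have SE B : s B = (lebesgue_stieltjes_measure G B + lebesgue_stieltjes_measure H B)%E.
  exact: measure_addE.
pose ki := NngNum (ltW (divr_gt0 ltr01 K0)).
have E A : measurable A -> mu A = mscale ki s A.
  move=> mA.
  apply: (@lebesgue_stieltjes_measure_unique R idfun (mscale ki s)) => //.
  move=> _ [[x y] _ <-] /=.
  have [xy|yx] := leP x y; last first.
    by rewrite set_itv_ge ?measure0// bnd_simp -leNgt ltW.
  rewrite lebesgue_stieltjes_oc// /mscale /=.
  rewrite [X in (_ * X)%E]SE.
  rewrite !lebesgue_stieltjes_oc// -EFinD -EFinM; congr EFin.
  have -> : G y - G x + (H y - H x) = K * y - K * x by rewrite -!GH; ring.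
  by field; rewrite gt_eqF.
apply/null_content_dominatesP => A mA muA0.
have : mscale ki s A = 0 by rewrite -E.
rewrite /mscale /= [X in (_ * X)%E]SE => /eqP; rewrite mule_eq0 eqe gt_eqF ?divr_gt0//=.
by rewrite padde_eq0 ?measure_ge0// => /andP[/eqP].
Qed.

Lemma lipschitz_continuous (f : R -> R) (K : R) :
  (forall x y, `|f x - f y| <= K * `|x - y|) -> continuous f.
Proof.
move=> fK x; apply/cvgrPdist_le => e e0.
have K1 : 0 < `|K| + 1 by rewrite ltr_wpDl.
near=> y; rewrite (le_trans (fK _ _))//.
have : `|x - y| <= e / (`|K| + 1).
  by near: y; apply: cvgr_dist_le; [exact: cvg_id|rewrite divr_gt0].
rewrite ler_pdivlMr// => h; apply: le_trans h; rewrite mulrC ler_wpM2l//.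
by rewrite (le_trans (ler_norm _))// lerDl.
Unshelve. all: by end_near. Qed.

(** The increments of [f + K x] lie between 0 and [2 K] times those of [x]. Hence [f + K x] and its
    complement to [2 K x] are both nondecreasing, and the Stieltjes measure of the former has a
    density [d]. *)
Lemma lipschitz_density (f : R -> R) (K a b : R) : a < b -> 0 < K ->
  (forall x y, x \in `[a, b] -> y \in `[a, b] -> `|f x - f y| <= K * `|x - y|) ->
  exists d : R -> R, [/\ forall x, 0 <= d x, mu.-integrable setT (EFin \o d),
    forall x, x \in `[a, b] ->
      f x = f a - K * (x - a) + \int[mu]_(t in `]a, x]) d t &
    {ae mu, forall x, x \in `]a, b[ -> is_derive x 1 f (d x - K)}].
Proof.
move=> ab K0 fK.
(* Clamping to [[a, b]] extends [f + K x] to a monotone continuous function on the whole line,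
   constant outside the interval. *)
pose c t := Num.max a (Num.min b t).
have cab t : c t \in `[a, b].
  by rewrite in_itv/= /c le_max lexx/= ge_max (ltW ab)/= ge_min lexx.
have cE t : t \in `[a, b] -> c t = t.
  by rewrite in_itv/= /c => /andP[at_ tb]; rewrite (min_idPr tb) (max_idPr at_).
have cm s t : s <= t -> 0 <= c t - c s <= t - s.
  rewrite /c => st; case: (leP b s) => ?; case: (leP b t) => ?; case: (leP a b) => ?;
    case: (leP a s) => ?; case: (leP a t) => ?; apply/andP; split; lra.
have cL s t : `|c s - c t| <= `|s - t|.
  have [st|/ltW st] := leP s t.
    by rewrite distrC (distrC s); rewrite !ger0_norm; have := cm _ _ st; lra.
  by rewrite !ger0_norm; have := cm _ _ st; lra.
pose g t := f (c t) + K * c t.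
pose h t := 2 * K * t - g t.
have fc s t : s <= t -> `|f (c s) - f (c t)| <= K * (c t - c s).
  move=> st; rewrite (le_trans (fK _ _ _ _))// distrC ger0_norm//.
  by have := cm _ _ st; lra.
have gm : nondecreasing g.
  move=> s t st; have := fc _ _ st; rewrite ler_norml /g; lra.
have hm : nondecreasing h.
  move=> s t st; have := fc _ _ st; rewrite ler_norml /h /g.
  have := cm _ _ st; have := ler_wpM2l (ltW K0) (_ : c t - c s <= t - s); lra.
have fL s t : `|f (c s) - f (c t)| <= K * `|s - t|.
  by rewrite (le_trans (fK _ _ _ _))// ler_wpM2l// ltW.
have gc : continuous g.
  apply: (@lipschitz_continuous _ (2 * K)) => s t.
  rewrite /g opprD addrACA -mulrBr (le_trans (ler_normD _ _))// normrM (gtr0_norm K0).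
  have := fL s t; have := ler_wpM2l (ltW K0) (cL s t); lra.
have hc : continuous h.
  move=> x; apply: cvgB; last exact: gc.
  by apply: cvgM; [exact: cvg_cst|exact: cvg_id].
have [G GE] : exists G : cumulative R R, G = g :> (R -> R).
  pose m := isCumulative.Build R _ R g gm (right_continuousW gc).
  by exists (HB.pack_for (cumulative R R) g m).
have [H HE] : exists H : cumulative R R, H = h :> (R -> R).
  pose m := isCumulative.Build R _ R h hm (right_continuousW hc).
  by exists (HB.pack_for (cumulative R R) h m).
have dom : lebesgue_stieltjes_measure G `<< mu.
  apply: (@lebesgue_stieltjes_dominated _ H (2 * K)); first by lra.
  by move=> x; rewrite GE HE /h; ring.
have moo : (lebesgue_stieltjes_measure G `]a, b] < +oo)%E.
  by rewrite lebesgue_stieltjes_oc ?ltry// ltW.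
pose nu : {finite_measure set (measurableTypeR R) -> \bar R} :=
  @mfrestr _ (measurableTypeR R) R _ (lebesgue_stieltjes_measure G)
    (measurable_itv `]a, b]) moo.
have nuE x : x \in `[a, b] -> nu `]a, x]%classic = (f x - f a + K * (x - a))%:E.
  move=> xab; have /andP[ax xb] : a <= x <= b by rewrite in_itv in xab.
  rewrite /nu /= /mfrestr /mrestr setIidl; last first.
    by apply: subset_itvl; rewrite bnd_simp.
  rewrite lebesgue_stieltjes_oc// GE /g !cE//; last by rewrite in_itv/= lexx ltW.
  by congr EFin; ring.
have numu : nu `<< mu.
  apply/null_content_dominatesP => A mA muA.
  rewrite /nu /= /mfrestr /mrestr.
  have /null_content_dominatesP dom0 := dom.
  apply/eqP; rewrite -measure_le0 -(dom0 _ mA muA).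
  by rewrite le_measure ?inE//; exact: measurableI.
have [D [D0 Dfin Dint DE]] := radon_nikodym_sigma_finite numu.
have dE : EFin \o (fine \o D) = D by apply/funext => x /=; rewrite fineK.
have FE x : x \in `[a, b] ->
    f x = f a - K * (x - a) + \int[mu]_(t in `]a, x]) (fine \o D) t.
  move=> xab; rewrite /Rintegral.
  under eq_integral do rewrite /= fineK//.
  by rewrite -DE// nuE//=; ring.
exists (fine \o D); split => //.
- by move=> x; rewrite fine_ge0.
- by rewrite dE.
have intd y : mu.-integrable [set` Interval (BRight a) (BRight y)] (EFin \o (fine \o D)).
  by rewrite dE; apply: (integrableS measurableT).
have locd : locally_integrable setT (fine \o D).
  by apply: open_integrable_locally; [exact: openT|rewrite dE].
have := FTC1 intd locd; apply: ae_mono => x.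
move=> FD xab; have [|dF F'] := FD.
  by rewrite lte_fin; move: xab; rewrite in_itv/= => /andP[].
have : is_derive x 1 (fun y : R => f a - K * (y - a) +
    \int[mu]_(t in `]a, y]) (fine \o D) t) (fine (D x) - K).
  have FD' : is_derive x 1 (fun y : R => \int[mu]_(t in `]a, y]) (fine \o D) t) (fine (D x)).
    by apply: (DeriveDef dF); rewrite -derive1E.
  apply: is_derive_eq.
  rewrite /GRing.scale/=; ring.
apply: near_eq_is_derive; near=> y; rewrite -FE//.
by apply: subset_itv_oo_cc; near: y; exact: near_in_itvoo.
Unshelve. all: by end_near. Qed.

Lemma lipschitz_ae_derivable (f : R -> R) (K : R) :
  (forall x y, `|f x - f y| <= K * `|x - y|) ->
  {ae mu, forall x, derivable f x 1}.
Proof.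
move=> fK.
have H (n : nat) : {ae mu, forall x, x \in `](- n.+1%:R : R), n.+1%:R[ -> derivable f x 1}.
  have [//|||d [_ _ _]] := @lipschitz_density f (`|K| + 1) (- n.+1%:R) n.+1%:R.
  - by rewrite (@lt_trans _ _ 0)// ?oppr_lt0.
  - by rewrite ltr_wpDl.
  - move=> x y _ _; rewrite (le_trans (fK _ _))// ler_wpM2r//.
    by rewrite (le_trans (ler_norm _))// lerDl.
  by apply: ae_mono => x + xn => /(_ xn) -[].
have := ae_foralln H; apply: ae_mono => x /(_ (Num.bound `|x|)); apply.
have xb : `|x| < (Num.bound `|x|).+1%:R.
  by rewrite (lt_le_trans (archi_boundP (normr_ge0 x)))// ler_nat.
by rewrite in_itv/= -ltr_norml.
Qed.

(** The increment of [f] is the integral of [d - L], and [d - L] coincides almost everywhere with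
    the derivative. *)
Lemma lipschitz_ae_nonincreasing (f : R -> R) (K a b : R) : a <= b ->
  (forall x y, x \in `[a, b] -> y \in `[a, b] -> `|f x - f y| <= K * `|x - y|) ->
  {ae mu, forall x, x \in `]a, b[ -> exists2 d, is_derive x 1 f d & d <= 0} ->
  f b <= f a.
Proof.
rewrite le_eqVlt => /predU1P[->//|ab] fK f'.
pose L := `|K| + 1.
have L0 : 0 < L by rewrite ltr_wpDl.
have [//|//||d [d0 dint fE fd]] := @lipschitz_density f L a b.
  move=> x y xab yab; rewrite (le_trans (fK _ _ _ _))// ler_wpM2r//.
  by rewrite (le_trans (ler_norm _))// lerDl.
rewrite fE; last by rewrite in_itv/= lexx ltW.
rewrite -addrA gerDl addrC subr_le0.
have mdd := measurable_int mu dint.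
rewrite -Rintegral_itv_bndo_bndc; last exact: (integrableS measurableT).
rewrite -lee_fin /Rintegral fineK; last first.
  by apply: integrable_fin_num => //; exact: (integrableS measurableT).
apply: (@le_trans _ _ (\int[mu]_(x in `]a, b[) L%:E)%E); last first.
  rewrite integral_cst// [X in (_ * X)%E]lebesgue_measure_itv.
  by rewrite /= lte_fin ab -EFinB -EFinM lexx.
apply: (@ae_ge0_le_integral _ _ _ mu _ _ (EFin \o d) (cst L%:E)) => //.
- by move=> x _; rewrite lee_fin.
- exact: measurable_funS mdd.
- by move=> x _; rewrite lee_fin ltW.
apply: ae_mono2 fd f' => x h1 h2 xab.
have [e [_ e1] e0] := h2 xab; have [_ e2] := h1 xab.
by rewrite lee_fin -subr_le0 -e2 e1.
Qed.

Lemma bounded_primitive (g : R -> R) (M : R) : measurable_fun setT g ->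
  (forall x, `|g x| <= M) -> exists G : R -> R,
  [/\ forall x y, `|G x - G y| <= M * `|x - y|, G 0 = 0 &
      {ae mu, forall x : R, is_derive x 1 G (g x)}].
Proof.
move=> mg gM.
have gb A : measurable A -> (mu A < +oo)%E -> mu.-integrable A (EFin \o g).
  move=> mA Aoo; apply: measurable_bounded_integrable => //.
    exact: measurable_funS mg.
  exists M; split; first exact: num_real.
  by move=> N MN x _ /=; rewrite (le_trans (gM x))// ltW.
have muoo x y : (mu `]x, y]%classic < +oo)%E.
  by rewrite lebesgue_measure_itv/=; case: ifP; rewrite ?ltry.
have gi x y : mu.-integrable `]x, y] (EFin \o g) by exact: gb.
have locg : locally_integrable setT g.
  split => //; first exact: openT.
  move=> A _ cA; have mA := compact_measurable cA.
  have /integrableP[_ ] := gb A mA (compact_finite_measure cA).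
  by under eq_integral do rewrite abse_EFin.
pose I x y := \int[mu]_(t in `]x, y]) g t.
have IB (x y z : R) : x <= y -> y <= z -> I x z - I x y = I y z.
  by move=> xy yz; rewrite /I Rintegral_itvB// bnd_simp.
(* The signed integral from 0 to [x]: one of the two terms is an integral over an empty interval. *)
pose G x := I 0 x - I x 0.
have I0 (x y : R) : y <= x -> I x y = 0.
  by move=> yx; rewrite /I set_itv_ge ?Rintegral_set0// bnd_simp -leNgt.
(* The fundamental theorem of calculus speaks of points to the right of a base point, so the base
   point is moved to an arbitrary [n <= 0]. *)
have GE (n x : R) : n <= 0 -> n <= x -> G x = I n x - I n 0.
  move=> n0 nx; rewrite /G; have [x0|/ltW x0] := leP 0 x.
    by rewrite (I0 x 0)// subr0 IB.
  by rewrite (I0 0 x)// sub0r -(IB n x 0)// opprB.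
exists G; split.
- have H x y : x <= y -> `|G x - G y| <= M * `|x - y|.
    move=> xy; pose n := Num.min 0 x.
    have n0 : n <= 0 by rewrite ge_min lexx.
    have nx : n <= x by rewrite ge_min lexx orbT.
    rewrite (GE n x n0 nx) (GE n y n0 (le_trans nx xy)) distrC.
    have -> : I n y - I n 0 - (I n x - I n 0) = I n y - I n x by ring.
    rewrite IB// (distrC x) (ger0_norm (_ : 0 <= y - x)) ?subr_ge0//.
    rewrite /I (le_trans (le_normr_Rintegral _ _))//.
    have -> : M * (y - x) = \int[mu]_(t in `]x, y]) M.
      rewrite Rintegral_cst// [X in fine X]lebesgue_measure_itv/= lte_fin.
      by have [//|yx] := ltP x y; rewrite (le_anti (_ : x <= y <= x)) ?xy// subrr/= ?mulr0.
    apply: le_Rintegral => //.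
    + by have := integrable_abse (gi x y).
    + apply: measurable_bounded_integrable => //; first exact: muoo.
      by exists `|M|; split; [exact: num_real|move=> N MN t _ /=; rewrite ltW].
  move=> x y; have [/H //|/ltW /H] := leP x y.
  by rewrite distrC (distrC x).
- by rewrite /G !I0// subrr.
have H (n : nat) : {ae mu, forall x : R, - n.+1%:R < x -> is_derive x 1 G (g x)}.
  have := FTC1 (fun y => gi (- n.+1%:R) y) locg; apply: ae_mono => x FD nx.
  have [|dF F'] := FD; first by rewrite lte_fin.
  have : is_derive x 1 (fun y : R => I (- n.+1%:R) y - I (- n.+1%:R) 0) (g x).
    have FD' : is_derive x 1 (fun y : R => I (- n.+1%:R) y) (g x).
      by apply: (DeriveDef dF); rewrite -derive1E.
    by apply: is_derive_eq; rewrite subr0.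
  apply: near_eq_is_derive; near=> y; rewrite (GE (- n.+1%:R))//.
  by rewrite ltW//; near: y; exact: lt_nbhsr.
have := ae_foralln H; apply: ae_mono => x /(_ (Num.bound `|x|)); apply.
have xb : `|x| < (Num.bound `|x|).+1%:R.
  by rewrite (lt_le_trans (archi_boundP (normr_ge0 x)))// ler_nat.
by move: xb; rewrite ltr_norml => /andP[].
Unshelve. all: by end_near. Qed.

Lemma ae_shift (P : R -> Prop) (T : R) :
  {ae mu, forall x, P x} -> {ae mu, forall x, P (x + T)}.
Proof.
pose f : measurableTypeR R -> measurableTypeR R := +%R^~ T.
have mf : measurable_fun setT f.
  by apply: measurable_funD.
move=> [A [mA A0 PA]]; exists (f @^-1` A); split.
- by rewrite -[X in measurable X]setTI; exact: mf.
- rewrite -A0 -[LHS]/(pushforward mu f A); apply/esym.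
  apply: lebesgue_measure_unique => //= _ [[x y] _ <-] /=.
  rewrite /pushforward.
  have -> : f @^-1` `]x, y] = `]x - T, y - T]%classic.
    by apply/seteqP; split => z /=; rewrite !in_itv/= /f ltrBlDr lerBrDr.
  by rewrite !lebesgue_measure_itv/= !lte_fin ltrD2r -!EFinB opprB addrA subrK.
- by move=> x /= nP; apply: PA.
Qed.

(** Truncating [g] at height [|M|] alters it only on a null set and makes the bound hold
    everywhere. *)
Lemma ae_bounded_primitive (g : R -> R) (M : R) : measurable_fun setT g ->
  {ae mu, forall x, `|g x| <= M} -> exists G : R -> R,
  [/\ forall x y, `|G x - G y| <= `|M| * `|x - y|, G 0 = 0 &
      {ae mu, forall x : R, is_derive x 1 G (g x)}].
Proof.
move=> mg gM; pose h x := Num.max (- `|M|) (Num.min `|M| (g x)).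
have mh : measurable_fun setT h.
  by apply: measurable_maxr => //; apply: measurable_minr.
have hM x : `|h x| <= `|M|.
  rewrite ler_norml /h le_max lexx/= ge_max ge_min lexx/= andbT.
  by rewrite (@le_trans _ _ 0)// oppr_le0.
have [G [G1 G2 G3]] := bounded_primitive mh hM.
exists G; split => //; apply: ae_mono2 _ G3 gM => x + gx.
have : `|g x| <= `|M| by rewrite (le_trans gx)// ler_norm.
rewrite ler_norml => /andP[g1 g2].
by rewrite /h (min_idPr g2) (max_idPr g1).
Qed.
End RealLine.

(** * Calculus of complex-valued functions *)

Section Modulus.
Context {R : realType}.
Local Notation normc := (@Normc.normc R).
Local Notation Re := (@complex.Re R).
Local Notation Im := (@complex.Im R).
Implicit Types (z w : R[i]).


Lemma normc_ge0 z : 0 <= normc z.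
Proof. by case: z => a b; exact: sqrtr_ge0. Qed.

Lemma normcX z n : normc (z ^+ n) = normc z ^+ n.
Proof.
elim: n => [|n IH]; first by rewrite !expr0 Normc.normc1.
by rewrite !exprS Normc.normcM IH.
Qed.

Lemma normc_nat n : normc n%:R = n%:R.
Proof. by rewrite normcMn Normc.normc1. Qed.

Lemma normcB z w : normc (z - w) = normc (w - z).
Proof. by rewrite -normcN opprB. Qed.

Lemma normc_sum (I : Type) (r : seq I) (P : pred I) (F : I -> R[i]) :
  normc (\sum_(i <- r | P i) F i) <= \sum_(i <- r | P i) normc (F i).
Proof.
elim/big_rec2: _ => [|i y z _ IH]; first by rewrite Normc.normc0.
by rewrite (le_trans (le_normcD _ _))// lerD2l.
Qed.

Lemma le_normcB z w : normc (z - w) <= normc z + normc w.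
Proof. by rewrite (le_trans (le_normcD _ _))// normcN. Qed.

Lemma le_normc_sub z w : normc z - normc w <= normc (z - w).
Proof. by rewrite lerBlDr -{1}(subrK w z) le_normcD. Qed.

Lemma Re_le_normc z : `|Re z| <= normc z.
Proof.
by case: z => a b /=; rewrite -sqrtr_sqr ler_wsqrtr// lerDl sqr_ge0.
Qed.

Lemma Im_le_normc z : `|Im z| <= normc z.
Proof.
by case: z => a b /=; rewrite -sqrtr_sqr ler_wsqrtr// lerDr sqr_ge0.
Qed.

Lemma normc_le_ReIm z : normc z <= `|Re z| + `|Im z|.
Proof.
case: z => a b /=; rewrite -[leRHS]ger0_norm ?addr_ge0// -sqrtr_sqr ler_wsqrtr//.
rewrite sqrrD !real_normK ?num_real// lerD2r lerDl.
by rewrite mulrn_wge0// mulr_ge0.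
Qed.

Lemma ReD z w : Re (z + w) = Re z + Re w. Proof. by case: z; case: w. Qed.
Lemma ImD z w : Im (z + w) = Im z + Im w. Proof. by case: z; case: w. Qed.
Lemma ReB z w : Re (z - w) = Re z - Re w. Proof. by case: z; case: w. Qed.
Lemma ImB z w : Im (z - w) = Im z - Im w. Proof. by case: z; case: w. Qed.
Lemma ReM z w : Re (z * w) = Re z * Re w - Im z * Im w.
Proof. by case: z; case: w. Qed.
Lemma ImM z w : Im (z * w) = Re z * Im w + Im z * Re w.
Proof. by case: z => a b; case: w => c d /=. Qed.

(** Cauchy-Schwarz in the plane: the left side is the real part of the product of [w] with the
    conjugate of [z]. *)
Lemma Re_conjM z w : Re z * Re w + Im z * Im w <= normc z * normc w.
Proof.
have := Re_le_normc (z^*%C * w); rewrite Normc.normcM.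
have -> : normc z^*%C = normc z by case: z => a b /=; rewrite sqrrN.
by apply: le_trans; rewrite ReM; case: z => a b; rewrite /= mulNr opprK ler_norm.
Qed.

Lemma sqr_normcE z : normc z ^+ 2 = Re z * Re z + Im z * Im z.
Proof. by case: z => a b /=; rewrite sqr_sqrtr ?addr_ge0 ?sqr_ge0// !expr2. Qed.

Lemma normc_subrXX (z w : R[i]) (s : R) n : normc z <= s -> normc w <= s ->
  normc (z ^+ n - w ^+ n) <= n%:R * s ^+ n.-1 * normc (z - w).
Proof.
move=> zs ws; rewrite subrXX Normc.normcM mulrC ler_wpM2r ?normc_ge0//.
rewrite (le_trans (normc_sum _ _ _))//.
have -> : n%:R * s ^+ n.-1 = \sum_(i < n) s ^+ n.-1.
  by rewrite sumr_const card_ord mulr_natl.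
apply: ler_sum => i _; rewrite Normc.normcM !normcX.
have {2}-> : n.-1 = (n.-1 - i + i)%N.
  by rewrite subnK// -ltnS prednK// (leq_ltn_trans _ (ltn_ord i)).
rewrite exprD ler_pM ?exprn_ge0 ?normc_ge0// lerXn2r ?nnegrE ?normc_ge0//.
- by rewrite (le_trans (normc_ge0 z)).
- by rewrite (le_trans (normc_ge0 z)).
Qed.

Lemma cvgC_normc_le (S : nat -> R[i]) z l (B : R) n : cvgC S l ->
  (forall m, (n <= m)%N -> normc (S m - z) <= B) -> normc (l - z) <= B.
Proof.
move=> Sl SB; apply/ler_addgt0Pr => e e0.
move: Sl => /cvgrPdist_lt /(_ _ e0)[k _ Sk].
have := Sk (maxn k n) (leq_maxl _ _); rewrite sub0r normrN ger0_norm ?normc_ge0// => h1.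
have h2 := SB _ (leq_maxr k n).
have -> : l - z = (S (maxn k n) - z) - (S (maxn k n) - l) by ring.
rewrite (le_trans (le_normcB _ _))//; lra.
Qed.

End Modulus.

Section ComplexCalculus.
Context {R : realType}.
Local Notation mu := (@lebesgue_measure R).
Local Notation normc := (@Normc.normc R).
Local Notation Re := (@complex.Re R).
Local Notation Im := (@complex.Im R).
Implicit Types (f g : R -> R[i]) (A : set R).

Definition is_deriveC f (x : R) (d : R[i]) :=
  is_derive x 1 (fun t => Re (f t)) (Re d) /\
  is_derive x 1 (fun t => Im (f t)) (Im d).

Lemma is_deriveC_deriveC f x d : is_deriveC f x d -> derivableC f x /\ deriveC f x = d.
Proof.
move=> [[f1 e1] [f2 e2]]; split; first exact: (conj f1 f2).
by rewrite /deriveC !derive1E e1 e2; case: d {e1 e2}.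
Qed.

Lemma derivableC_is_deriveC f x : derivableC f x -> is_deriveC f x (deriveC f x).
Proof.
move=> [f1 f2]; split; [apply: (DeriveDef f1)|apply: (DeriveDef f2)].
  by rewrite /= derive1E.
by rewrite /= derive1E.
Qed.

Lemma is_deriveC_cst (c : R[i]) x : is_deriveC (fun=> c) x 0.
Proof. by split; exact: is_derive_cst. Qed.

Lemma is_deriveCD f g x d e : is_deriveC f x d -> is_deriveC g x e ->
  is_deriveC (fun t => f t + g t) x (d + e).
Proof.
move=> [f1 f2] [g1 g2]; split.
  rewrite ReD (_ : (fun t => Re (f t + g t)) = (fun t => Re (f t) + Re (g t))).
    exact: is_deriveD.
  by apply/funext => t; rewrite ReD.
rewrite ImD (_ : (fun t => Im (f t + g t)) = (fun t => Im (f t) + Im (g t))).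
  exact: is_deriveD.
by apply/funext => t; rewrite ImD.
Qed.

Lemma is_deriveCM f g x d e : is_deriveC f x d -> is_deriveC g x e ->
  is_deriveC (fun t => f t * g t) x (d * g x + f x * e).
Proof.
move=> [f1 f2] [g1 g2]; split.
  rewrite (_ : (fun t => Re (f t * g t)) =
    (fun t => Re (f t) * Re (g t) - Im (f t) * Im (g t))).
    apply: is_derive_eq; rewrite ReD !ReM /GRing.scale/=; ring.
  by apply/funext => t; rewrite ReM.
rewrite (_ : (fun t => Im (f t * g t)) =
  (fun t => Re (f t) * Im (g t) + Im (f t) * Re (g t))).
  apply: is_derive_eq; rewrite ImD !ImM /GRing.scale/=; ring.
by apply/funext => t; rewrite ImM.
Qed.

Lemma is_deriveC_eq f x d e : is_deriveC f x d -> d = e -> is_deriveC f x e.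
Proof. by move=> + <-. Qed.

Lemma is_deriveCX f x d n : is_deriveC f x d ->
  is_deriveC (fun t => f t ^+ n.+1) x (n.+1%:R * f x ^+ n * d).
Proof.
move=> fd; elim: n => [|n IH].
  by rewrite (_ : (fun t => f t ^+ 1) = f) ?expr0 ?mulr1 ?mul1r//; exact/funext.
have -> : (fun t => f t ^+ n.+2) = (fun t => f t * f t ^+ n.+1).
  by apply/funext => t; rewrite exprS.
apply: is_deriveC_eq (is_deriveCM fd IH) _.
by rewrite [n.+2%:R]mulrS exprS; ring.
Qed.

Lemma is_deriveC_sum n (F : nat -> R -> R[i]) (D : nat -> R[i]) x :
  (forall i, (i < n)%N -> is_deriveC (F i) x (D i)) ->
  is_deriveC (fun t => \sum_(i < n) F i t) x (\sum_(i < n) D i).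
Proof.
elim: n => [|n IH] FD.
  rewrite big_ord0 (_ : (fun t => _) = fun=> 0); first exact: is_deriveC_cst.
  by apply/funext => t; rewrite big_ord0.
rewrite big_ord_recr (_ : (fun t => _) = fun t => \sum_(i < n) F i t + F n t).
  by apply: is_deriveCD; [apply: IH => i /ltnW /FD|exact: FD].
by apply/funext => t; rewrite big_ord_recr.
Qed.

(** Boundedness is included because it makes the class closed under products. *)
Definition blipschitz A f :=
  lipschitzC A f /\ exists B : R, forall x, A x -> normc (f x) <= B.

Lemma blipschitz_cst A (c : R[i]) : blipschitz A (fun=> c).
Proof.
split; last by exists (normc c).
by exists 0 => x y _ _; rewrite subrr Normc.normc0 mul0r.
Qed.

Lemma blipschitzD A f g : blipschitz A f -> blipschitz A g ->
  blipschitz A (fun t => f t + g t).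
Proof.
move=> [[K fK] [B fB]] [[L gL] [C gC]]; split.
  exists (K + L) => x y Ax Ay; rewrite opprD addrACA mulrDl.
  by rewrite (le_trans (le_normcD _ _))// lerD ?fK ?gL.
by exists (B + C) => x Ax; rewrite (le_trans (le_normcD _ _))// lerD ?fB ?gC.
Qed.

Lemma normc_subM (a b c d : R[i]) :
  normc (a * b - c * d) <= normc (a - c) * normc b + normc c * normc (b - d).
Proof.
have -> : a * b - c * d = (a - c) * b + c * (b - d) by ring.
by rewrite (le_trans (le_normcD _ _))// !Normc.normcM.
Qed.

Lemma blipschitzM A f g : blipschitz A f -> blipschitz A g ->
  blipschitz A (fun t => f t * g t).
Proof.
move=> [[K fK] [B fB]] [[L gL] [C gC]]; split.
  exists (K * C + B * L) => x y Ax Ay; rewrite (le_trans (normc_subM _ _ _ _))//.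
  rewrite mulrDl lerD//.
    by rewrite mulrAC ler_pM ?normc_ge0 ?fK ?gC.
  by rewrite -mulrA ler_pM ?normc_ge0 ?fB ?gL.
by exists (B * C) => x Ax; rewrite Normc.normcM ler_pM ?normc_ge0 ?fB ?gC.
Qed.

Lemma blipschitzX A f n : blipschitz A f -> blipschitz A (fun t => f t ^+ n).
Proof.
move=> fb; elim: n => [|n IH].
  by rewrite (_ : (fun t => _) = fun=> 1); [exact: blipschitz_cst|exact/funext].
rewrite (_ : (fun t => _) = fun t => f t * f t ^+ n); first exact: blipschitzM.
by apply/funext => t; rewrite exprS.
Qed.

Lemma blipschitz_sum A n (F : nat -> R -> R[i]) :
  (forall i, (i < n)%N -> blipschitz A (F i)) ->
  blipschitz A (fun t => \sum_(i < n) F i t).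
Proof.
elim: n => [|n IH] FA.
  rewrite (_ : (fun t => _) = fun=> 0); first exact: blipschitz_cst.
  by apply/funext => t; rewrite big_ord0.
rewrite (_ : (fun t => _) = fun t => \sum_(i < n) F i t + F n t).
  by apply: blipschitzD; [apply: IH => i /ltnW /FA|exact: FA].
by apply/funext => t; rewrite big_ord_recr.
Qed.

Lemma lipschitzC_blipschitz f a b : lipschitzC `[a, b] f -> blipschitz `[a, b] f.
Proof.
move=> fl; split => //; case: fl => K fK.
have [ab|ba] := leP a b; last first.
  by exists 0 => x /=; rewrite in_itv/= => /andP[ax /(le_trans ax)]; rewrite leNgt ba.
exists (normc (f a) + `|K| * (b - a)) => x xab.
have aab : `[a, b]%classic a by rewrite /= in_itv/= lexx.
have := fK _ _ xab aab; have := le_normc_sub (f x) (f a) => h1 h2.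
have xab' : a <= x <= b by move: xab; rewrite /= in_itv.
have : K * `|x - a| <= `|K| * (b - a).
  apply: (@le_trans _ _ (`|K| * `|x - a|)); first by rewrite ler_wpM2r// ler_norm.
  by rewrite ler_wpM2l// ger0_norm; lra.
lra.
Qed.

Lemma lipschitzCS A A' f : A `<=` A' -> lipschitzC A' f -> lipschitzC A f.
Proof. by move=> AA' [K fK]; exists K => x y /AA' Ax /AA' Ay; exact: fK. Qed.

Lemma lipschitzC_Re A f K : (forall x y, A x -> A y -> normc (f x - f y) <= K * `|x - y|) ->
  forall x y, A x -> A y -> `|Re (f x) - Re (f y)| <= K * `|x - y|.
Proof. by move=> fK x y Ax Ay; rewrite -ReB (le_trans (Re_le_normc _))// fK. Qed.

Lemma lipschitzC_Im A f K : (forall x y, A x -> A y -> normc (f x - f y) <= K * `|x - y|) ->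
  forall x y, A x -> A y -> `|Im (f x) - Im (f y)| <= K * `|x - y|.
Proof. by move=> fK x y Ax Ay; rewrite -ImB (le_trans (Im_le_normc _))// fK. Qed.

Lemma lipschitzC_ae_derivable f : lipschitzC setT f ->
  {ae mu, forall x, is_deriveC f x (deriveC f x)}.
Proof.
move=> [K fK].
have h1 := lipschitz_ae_derivable (fun x y => lipschitzC_Re fK (I : setT x) (I : setT y)).
have h2 := lipschitz_ae_derivable (fun x y => lipschitzC_Im fK (I : setT x) (I : setT y)).
by apply: ae_mono2 h1 h2 => x d1 d2; apply: derivableC_is_deriveC; exact: (conj d1 d2).
Qed.

(* Tested against the direction c = f b - f a, the increment is that of a real
   function whose derivative is at most |c| h'. *)
Lemma normc_increment_le f (h h' : R -> R) (a b L : R) : a <= b ->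
  lipschitzC `[a, b] f ->
  (forall x y, x \in `[a, b] -> y \in `[a, b] -> `|h x - h y| <= L * `|x - y|) ->
  (forall x, x \in `]a, b[ -> is_derive x 1 h (h' x)) ->
  {ae mu, forall x, x \in `]a, b[ -> exists2 d, is_deriveC f x d & normc d <= h' x} ->
  normc (f b - f a) <= h b - h a.
Proof.
move=> ab [K fK] hL hh' fd; set c := f b - f a.
pose phi t := Re c * Re (f t) + Im c * Im (f t) - normc c * h t.
have phi_le : phi b <= phi a.
  apply: (@lipschitz_ae_nonincreasing _ phi (normc c * K + normc c * K + normc c * L) a b ab).
    move=> x y xab yab.
    have -> : phi x - phi y = Re c * (Re (f x) - Re (f y)) + Im c * (Im (f x) - Im (f y))
      - normc c * (h x - h y) by rewrite /phi; ring.
    rewrite (le_trans (ler_normB _ _))// !mulrDl lerD//; last first.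
      by rewrite normrM ger0_norm ?normc_ge0// -mulrA ler_wpM2l ?normc_ge0// hL.
    rewrite (le_trans (ler_normD _ _))// !normrM -!mulrA lerD//.
      by rewrite ler_pM// ?Re_le_normc// (lipschitzC_Re fK).
    by rewrite ler_pM// ?Im_le_normc// (lipschitzC_Im fK).
  apply: ae_mono fd => x fd xab; have [d [f1 f2] dh] := fd xab.
  have hx := hh' x xab.
  exists (Re c * Re d + Im c * Im d - normc c * h' x).
    by apply: is_derive_eq; rewrite /GRing.scale/=; ring.
  rewrite subr_le0 (le_trans (Re_conjM _ _))// ler_wpM2l ?normc_ge0//.
(* When [c = 0] the test function [phi] carries no information, and the claim is just the
   monotonicity of [h]. *)
have h_le : h a <= h b.
  rewrite -lerN2; apply: (@lipschitz_ae_nonincreasing _ (fun t => - h t) L a b ab).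
    by move=> x y xab yab; rewrite -opprD normrN hL.
  apply: ae_mono fd => x fd xab; have [d _ dh] := fd xab.
  have hx := hh' x xab; exists (- h' x); first exact: is_deriveN.
  by rewrite oppr_le0 (le_trans (normc_ge0 d)).
have [c0|c0] := eqVneq (normc c) 0; first by rewrite c0 subr_ge0.
have {}c0 : 0 < normc c by rewrite lt_def c0 normc_ge0.
rewrite -(ler_pM2l c0) -expr2 sqr_normcE.
have e1 : Re c * Re c = Re c * Re (f b) - Re c * Re (f a) by rewrite -mulrBr -ReB.
have e2 : Im c * Im c = Im c * Im (f b) - Im c * Im (f a) by rewrite -mulrBr -ImB.
by move: phi_le; rewrite e1 e2 /phi; lra.
Qed.

Lemma normc_increment_leM f (a b M : R) : a <= b -> lipschitzC `[a, b] f ->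
  {ae mu, forall x, x \in `]a, b[ -> exists2 d, is_deriveC f x d & normc d <= M} ->
  normc (f b - f a) <= M * (b - a).
Proof.
move=> ab fl fd.
have -> : M * (b - a) = M * b - M * a by ring.
apply: (@normc_increment_le f (fun t => M * t) (fun=> M) a b `|M|) => //.
  by move=> x y _ _; rewrite -mulrBr normrM.
by move=> x _; apply: is_derive_eq; rewrite /GRing.scale/= mulr1.
Qed.

Lemma is_derive_norm_le (f : R -> R) (x d K : R) : is_derive x 1 f d ->
  (forall y, `|f x - f y| <= K * `|x - y|) -> `|d| <= K.
Proof.
move=> [fx <-] fK; apply/ler_addgt0Pr => e e0.
have /cvgrPdist_lt /(_ _ e0) dq : h^-1 *: (f (h *: 1 + x) - f x) @[h --> 0^'] --> 'D_1 f x.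
  exact: fx.
near (0 : R)^' => h.
have h0 : h != 0 by near: h; exact: nbhs_dnbhs_neq.
have h1 : `|'D_1 f x - h^-1 *: (f (h *: 1 + x) - f x)| < e by near: h.
have h2 : `|h^-1 *: (f (h *: 1 + x) - f x)| <= K.
  rewrite normrZ normfV mulrC ler_pdivrMr ?normr_gt0// distrC (le_trans (fK _))//.
  by rewrite opprD addrCA subrr addr0 normrN [_ *: _]mulr1.
rewrite -(subrK (h^-1 *: (f (h *: 1 + x) - f x)) ('D_1 f x)) (le_trans (ler_normD _ _))//.
lra.
Unshelve. all: by end_near. Qed.

(** The factor 2 comes from bounding the real and imaginary parts separately. *)
Lemma is_deriveC_normc_le f (x : R) d (K : R) : is_deriveC f x d ->
  (forall y, normc (f x - f y) <= K * `|x - y|) -> normc d <= 2 * K.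
Proof.
move=> [f1 f2] fK; rewrite (le_trans (normc_le_ReIm _))// mulr_natl mulr2n lerD//.
  by apply: (is_derive_norm_le f1) => y; rewrite -ReB (le_trans (Re_le_normc _)).
by apply: (is_derive_norm_le f2) => y; rewrite -ImB (le_trans (Im_le_normc _)).
Qed.

Lemma primitiveC f (M : R) : measurable_fun setT (Re \o f) ->
  measurable_fun setT (Im \o f) -> {ae mu, forall x, normc (f x) <= M} ->
  exists G : R -> R[i], [/\ lipschitzC setT G, G 0 = 0 &
    {ae mu, forall x, is_deriveC G x (f x)}].
Proof.
move=> m1 m2 fM.
have [|G [GL G0 G']] := @ae_bounded_primitive R (Re \o f) M m1.
  by apply: ae_mono fM => x; apply: le_trans; exact: Re_le_normc.
have [|H [HL H0 H']] := @ae_bounded_primitive R (Im \o f) M m2.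
  by apply: ae_mono fM => x; apply: le_trans; exact: Im_le_normc.
exists (fun t => G t +i* H t); split.
- exists (`|M| + `|M|) => x y _ _; rewrite (le_trans (normc_le_ReIm _))//.
  by rewrite ReB ImB /= mulrDl lerD.
- by rewrite G0 H0.
- by apply: ae_mono2 G' H' => x G' H'; split.
Qed.

Definition measurableC f :=
  measurable_fun setT (fun x => Re (f x)) /\ measurable_fun setT (fun x => Im (f x)).

Lemma measurableCD f g : measurableC f -> measurableC g -> measurableC (fun t => f t + g t).
Proof.
move=> [f1 f2] [g1 g2]; split.
  by under eq_fun do rewrite ReD; exact: measurable_funD.
by under eq_fun do rewrite ImD; exact: measurable_funD.
Qed.

Lemma measurableCM f g : measurableC f -> measurableC g -> measurableC (fun t => f t * g t).
Proof.
move=> [f1 f2] [g1 g2]; split.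
  by under eq_fun do rewrite ReM; apply: measurable_funB; exact: measurable_funM.
by under eq_fun do rewrite ImM; apply: measurable_funD; exact: measurable_funM.
Qed.

Lemma measurableC_cst (c : R[i]) : measurableC (fun=> c).
Proof. by split; exact: measurable_cst. Qed.

Lemma measurableC_sum n (F : nat -> R -> R[i]) :
  (forall i, (i < n)%N -> measurableC (F i)) ->
  measurableC (fun t => \sum_(i < n) F i t).
Proof.
elim: n => [|n IH] FA.
  rewrite (_ : (fun t => _) = fun=> 0); first exact: measurableC_cst.
  by apply/funext => t; rewrite big_ord0.
rewrite (_ : (fun t => _) = fun t => \sum_(i < n) F i t + F n t).
  by apply: measurableCD; [apply: IH => i /ltnW /FA|exact: FA].
by apply/funext => t; rewrite big_ord_recr.
Qed.

Lemma lipschitzC_measurable f : lipschitzC setT f -> measurableC f.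
Proof.
move=> [K fK]; split; apply: continuous_measurable_fun; apply: (@lipschitz_continuous _ _ K).
  by move=> x y; exact: (lipschitzC_Re fK).
by move=> x y; exact: (lipschitzC_Im fK).
Qed.

End ComplexCalculus.

(** * The recursion for the coefficients of a first integral *)

Section FormalSeries.
Variable F : fieldType.
Implicit Types e f g h : nat -> F.

(** Coefficients of a product up to order [n] depend only on the truncations at order [n], so the
    laws of series multiplication are inherited from polynomials. *)
Let trunc n f : {poly F} := \poly_(i < n.+1) f i.

Let coef_trunc n f i : (i <= n)%N -> (trunc n f)`_i = f i.
Proof. by move=> i_n; rewrite coef_poly ltnS i_n. Qed.

Let fps_mulE n f g i : (i <= n)%N -> fps_mul f g i = (trunc n f * trunc n g)`_i.
Proof.
move=> i_n; rewrite coefM; apply: eq_bigr => j _.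
have ji : (j <= i)%N by rewrite -ltnS ltn_ord.
by rewrite !coef_trunc// (leq_trans _ i_n)// leq_subr.
Qed.

Lemma fps_mulC f g n : fps_mul f g n = fps_mul g f n.
Proof. by rewrite !(@fps_mulE n)// mulrC. Qed.

Lemma fps_mulA e f g n : fps_mul (fps_mul e f) g n = fps_mul e (fps_mul f g) n.
Proof.
transitivity (((trunc n e * trunc n f) * trunc n g)`_n).
  rewrite coefM; apply: eq_bigr => j _.
  have jn : (j <= n)%N by rewrite -ltnS ltn_ord.
  by rewrite -(fps_mulE _ _ jn) coef_trunc// leq_subr.
rewrite -mulrA coefM; apply: eq_bigr => j _.
have jn : (j <= n)%N by rewrite -ltnS ltn_ord.
by rewrite -(fps_mulE _ _ (leq_subr j n)) coef_trunc.
Qed.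

Lemma fps_mul1 f n : fps_mul f (fun k => (k == 0%N)%:R) n = f n.
Proof.
rewrite /fps_mul big_ord_recr/= subnn eqxx mulr1 big1 ?add0r// => i _.
by rewrite subn_eq0 leqNgt ltn_ord mulr0.
Qed.

Lemma fps_divP e f g : g 0%N != 0 ->
  (forall n, e n = fps_opp (fps_div f g) n) <-> (forall n, f n = - fps_mul e g n).
Proof.
move=> g0; have gV n : fps_mul (fps_inv g) g n = (n == 0%N)%:R by exact: fps_mulVf.
split=> H n.
  have -> : fps_mul e g n = - fps_mul (fps_div f g) g n.
    by rewrite /fps_mul -sumrN; apply: eq_bigr => i _; rewrite H mulNr.
  rewrite opprK /fps_div fps_mulA -[LHS]fps_mul1.
  by apply: eq_bigr => i _; rewrite gV.
have -> : fps_opp (fps_div f g) n = fps_mul (fps_mul e g) (fps_inv g) n.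
  rewrite /fps_opp /fps_div /fps_mul -sumrN; apply: eq_bigr => i _.
  by rewrite H mulNr opprK.
rewrite fps_mulA -[LHS]fps_mul1; apply: eq_bigr => i _.
by rewrite fps_mulC gV.
Qed.

End FormalSeries.

Section Transport.
Variable K : comNzRingType.
Implicit Types (a u d : nat -> K).

(* With the shifted indices of the statement, [- transport_coef a u n] is the
   derivative prescribed for u n, and [transport_rest] is what remains of
   F_x + (sum_i a_i t^(i+2)) F_t at t = v when both series are cut at order N. *)
Definition transport_coef a u n : K :=
  a n + \sum_(k < n) k.+2%:R * u k * a (n.-1 - k)%N.

Definition transport_rest a u N (v : K) : K :=
  \sum_(k < N) \sum_(i < N | (N <= i + k.+1)%N)
    k.+2%:R * u k * a i * v ^+ (i + k).+3.

Lemma sum_ord_shift N k (f : nat -> K) :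
  \sum_(n < N | (k < n)%N) f n = \sum_(i < N | ~~ (N <= i + k.+1)%N) f (i + k.+1)%N.
Proof.
transitivity (\sum_(k.+1 <= n < N) f n).
  by rewrite (big_nat_widenl _ 0)// big_mkord.
rewrite -{1}(add0n k.+1) big_addn (big_nat_widen _ _ N) ?leq_subr// big_mkord.
by apply: eq_bigl => i /=; rewrite -ltnNge ltn_subRL addnC.
Qed.

(** Multiplied out, the product has a monomial of degree [i + k + 3] for each pair [k, i < N]. If
    [i + k + 1 < N], it cancels against the recursion for [d (i + k + 1)]; the other pairs are the
    remainder. *)
Lemma transport_identity a u d N (v : K) :
  (forall n, (n < N)%N -> d n = - transport_coef a u n) ->
  (1 + \sum_(k < N) k.+2%:R * u k * v ^+ k.+1) * (\sum_(i < N) a i * v ^+ i.+2)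
    + \sum_(n < N) d n * v ^+ n.+2 = transport_rest a u N v.
Proof.
move=> dE.
have -> : \sum_(n < N) d n * v ^+ n.+2 =
    - \sum_(n < N) a n * v ^+ n.+2
    - \sum_(n < N) \sum_(k < n) k.+2%:R * u k * a (n.-1 - k)%N * v ^+ n.+2.
  rewrite -!sumrN -big_split/=; apply: eq_bigr => n _.
  by rewrite dE// mulNr mulrDl opprD; congr (- _ - _); rewrite mulr_suml.
rewrite mulrDl mul1r addrACA subrr add0r mulr_suml.
apply/eqP; rewrite subr_eq; apply/eqP.
rewrite (eq_bigr (fun k : 'I_N =>
  \sum_(i < N) k.+2%:R * u k * a i * v ^+ (i + k).+3)); last first.
  move=> k _; rewrite mulr_sumr; apply: eq_bigr => i _.
  have -> : (i + k).+3 = (k.+1 + i.+2)%N by rewrite addSn !addnS addnC.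
  by rewrite exprD; ring.
have -> : \sum_(n < N) \sum_(k < n) k.+2%:R * u k * a (n.-1 - k)%N * v ^+ n.+2 =
    \sum_(k < N) \sum_(i < N | ~~ (N <= i + k.+1)%N) k.+2%:R * u k * a i * v ^+ (i + k).+3.
  pose G (n k : nat) := k.+2%:R * u k * a (n.-1 - k)%N * v ^+ n.+2.
  rewrite (eq_bigr (fun n : 'I_N => \sum_(k < N | (k < n)%N) G n k)); last first.
    by move=> n _; rewrite (@big_ord_widen _ _ _ n N (G n) (ltnW (ltn_ord n))).
  rewrite (exchange_big_dep xpredT)//=; apply: eq_bigr => k _.
  rewrite (@sum_ord_shift N k (fun n => G n k)).
  by apply: eq_bigr => i _; rewrite /G !addnS/= addnK.
rewrite -big_split/=; apply: eq_bigr => k _.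
by rewrite [LHS](bigID (fun i : 'I_N => (N <= i + k.+1)%N)).
Qed.

End Transport.

(** * Estimates for the recursion *)

Section TransportBounds.
Context {R : realType}.
Local Notation mu := (@lebesgue_measure R).
Local Notation normc := (@Normc.normc R).

(** Once the denominator is cleared, coefficient [n.+2] is the recursion for [u n], while
    coefficients 0 and 1 vanish on both sides. *)
Lemma series_transportP (a u : nat -> R -> R[i]) (x : R) :
  (forall n, equation_series a x n =
     fps_opp (fps_div (numerator_series u x) (denominator_series u x)) n) <->
  (forall n, deriveC (u n) x = - transport_coef (a ^~ x) (u ^~ x) n).
Proof.
have E n : fps_mul (equation_series a x) (denominator_series u x) n.+2 =
    transport_coef (a ^~ x) (u ^~ x) n.
  rewrite /fps_mul big_ord_recl big_ord_recl big_ord_recr/= !mul0r !add0r subnn/= mulr1 addrC.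
  congr (_ + _); rewrite (reindex_inj rev_ord_inj)/=; apply: eq_bigr => i _.
  have := ltn_ord i; case: n i => [[]//|n] i ni.
  rewrite /bump /= !add1n !subSS add0n mulrC.
  have -> : (n.+1 - (n - i) = i.+1)%N by rewrite subSn ?leq_subr// subKn.
  by [].
rewrite fps_divP ?oner_neq0//; split=> H n.
  by have := H n.+2; rewrite /= E.
case: n => [|[|n]].
- by rewrite /fps_mul big_ord1/= mul0r oppr0.
- by rewrite /fps_mul !big_ord_recl big_ord0/= !mul0r !addr0 oppr0.
- by rewrite E -H.
Qed.

Lemma in_X_ae_bound (a : nat -> R -> R[i]) : in_X a -> exists2 l : R, 0 < l &
  {ae mu, forall x, forall i, normc (a i x) <= l ^+ i.+1}.
Proof.
move=> [_ [l l0 al]]; exists l => //; apply: ae_foralln => i.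
have := al i; rewrite /Linfty_norm unlock.
(* The norm of order infinity unfolds to an essential supremum only on a space of positive
   measure. *)
have -> : (0 < mu setT)%E.
  apply: (@lt_le_trans _ _ (mu `[0, 1]%classic)); last by rewrite le_measure ?inE.
  by rewrite lebesgue_measure_itv/= lte_fin ltr01 sube0 lte_fin.
move=> /ess_supP; apply: ae_mono => x /=.
by rewrite lee_fin ger0_norm ?normc_ge0.
Qed.

Lemma geometric_le (q : R) n m : 0 <= q <= 2^-1 -> \sum_(n <= k < m) q ^+ k <= 2 * q ^+ n.
Proof.
move=> /andP[q0 q1]; have [nm|mn] := leqP n m; last first.
  by rewrite big_geq 1?ltnW// mulr_ge0// exprn_ge0.
(* The subtracted term makes the estimate inductive: the new summand [q ^+ m] is paid for by
   [q <= 1/2]. *)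
suff : \sum_(n <= k < m) q ^+ k <= 2 * q ^+ n - 2 * q ^+ m.
  by have := exprn_ge0 m q0; lra.
rewrite -(subnK nm); elim: (m - n)%N => [|p IH].
  by rewrite big_geq// subrr.
rewrite addSn big_nat_recr ?leq_addl//= exprS.
have := ler_wpM2r (exprn_ge0 (p + n) q0) q1; lra.
Qed.

Lemma geometric1_le (q : R) m : 0 <= q <= 2^-1 -> \sum_(k < m) q ^+ k.+1 <= 2 * q.
Proof.
move=> q01; have := geometric_le 1 m.+1 q01.
by rewrite big_add1/= big_mkord expr1.
Qed.

(** There are at most [N ^ 2] monomials, each bounded by [s * (c * s) ^+ (i + k).+2], and
    [N <= i + k + 1] makes this exponent at least [N.+1]. *)
Lemma transport_rest_le (a u : nat -> R[i]) (c s : R) N v :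
  0 <= c -> 0 <= s -> c * s <= 1 ->
  (forall k, (k < N)%N -> k.+2%:R * normc (u k) <= c ^+ k.+1) ->
  (forall i, normc (a i) <= c ^+ i.+1) -> normc v <= s ->
  normc (transport_rest a u N v) <= N%:R ^+ 2 * (s * (c * s) ^+ N.+1).
Proof.
move=> c0 s0 cs uc ac vs; set B := s * _.
have B0 : 0 <= B by apply: mulr_ge0 => //; apply: exprn_ge0; exact: mulr_ge0.
have sumB (F : 'I_N -> R) C : 0 <= C -> (forall i, F i <= C) -> \sum_(i < N) F i <= N%:R * C.
  move=> C0 FC; rewrite (le_trans (ler_sum _ (fun i _ => FC i)))//.
  by rewrite sumr_const card_ord mulr_natl.
rewrite expr2 -mulrA (le_trans (normc_sum _ _ _))// sumB ?(mulr_ge0 (ler0n _ N) B0)// => k.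
rewrite (le_trans (normc_sum _ _ _))// big_mkcond/= sumB// => i.
case: ifP => // Nik; rewrite Normc.normcM normcX 2!Normc.normcM normc_nat.
apply: (@le_trans _ _ (c ^+ k.+1 * c ^+ i.+1 * s ^+ (i + k).+3)).
  apply: ler_pM; [by rewrite !mulr_ge0 ?normc_ge0|exact/exprn_ge0/normc_ge0| |].
    by rewrite ler_pM ?mulr_ge0 ?normc_ge0 ?uc.
  by rewrite lerXn2r ?nnegrE ?normc_ge0.
have -> : c ^+ k.+1 * c ^+ i.+1 * s ^+ (i + k).+3 = s * (c * s) ^+ (i + k).+2.
  rewrite -exprD addSn addnS (addnC k) exprMn [s ^+ (i + k).+3]exprS; ring.
rewrite ler_wpM2l//; apply: ler_wiXn2l => //; first exact: mulr_ge0.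
by rewrite ltnS -addnS.
Qed.

(** Every summand carries the same power [l ^+ k.+1]. What is left is [1 + y + ... + y ^ k], at most
    [2 * y ^+ k] because [2 <= y]. *)
Lemma transport_coef_le (a u : nat -> R[i]) (l y : R) k :
  0 <= l -> 2 <= y -> (forall i, normc (a i) <= l ^+ i.+1) ->
  (forall j, (j < k)%N -> j.+2%:R * normc (u j) <= (l * y) ^+ j.+1) ->
  normc (transport_coef a u k) <= 2 * l ^+ k.+1 * y ^+ k.
Proof.
move=> l0 y2 al ul; have y0 : 0 <= y by lra.
apply: (@le_trans _ _ (l ^+ k.+1 * (1 + \sum_(j < k) y ^+ j.+1))).
  rewrite (le_trans (le_normcD _ _))// mulrDr mulr1 lerD// mulr_sumr.
  rewrite (le_trans (normc_sum _ _ _))// ler_sum// => j _.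
  rewrite !Normc.normcM normc_nat.
  apply: (@le_trans _ _ ((l * y) ^+ j.+1 * l ^+ (k.-1 - j).+1)).
    by rewrite ler_pM ?mulr_ge0 ?normc_ge0 ?ul.
  have e : k.+1 = (j.+1 + (k.-1 - j).+1)%N.
    have := ltn_ord j; case: k j {ul} => // k j.
    by rewrite ltnS /= addSn addnS => ?; rewrite subnKC.
  by rewrite [in leRHS]e exprD exprMn; lra.
rewrite (mulrC 2) -mulrA ler_wpM2l ?exprn_ge0//.
elim: k {ul} => [|k IH]; first by rewrite big_ord0; lra.
rewrite big_ord_recr/= exprS.
have := ler_wpM2r (exprn_ge0 k y0) y2; lra.
Qed.

Lemma normc_real (t : R) : normc t%:C = `|t|.
Proof. by rewrite /= expr0n/= addr0 sqrtr_sqr. Qed.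

Lemma ler_norm_subrXX (p q s : R) n : `|p| <= s -> `|q| <= s ->
  `|p ^+ n - q ^+ n| <= n%:R * s ^+ n.-1 * `|p - q|.
Proof.
rewrite -!normc_real => ps qs; rewrite !rmorphB !rmorphXn.
exact: normc_subrXX.
Qed.

Section TransportSystem.
Variables (a u : nat -> R -> R[i]) (l : R) (N : nat).
Hypothesis l0 : 0 < l.
Hypothesis al : {ae mu, forall x, forall i, normc (a i x) <= l ^+ i.+1}.
Hypothesis uL : forall k, (k < N)%N -> lipschitzC setT (u k).
Hypothesis u0 : forall k, (k < N)%N -> u k 0 = 0.
Hypothesis u' : forall k, (k < N)%N ->
  {ae mu, forall x, is_deriveC (u k) x (- transport_coef (a ^~ x) (u ^~ x) k)}.

(* The shrinking radius of convergence along the characteristics is absorbed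
   by letting the geometric ratio l (2 + 4 x) grow linearly with x. *)
Lemma transport_bound k (x : R) : (k < N)%N -> 0 <= x ->
  k.+2%:R * normc (u k x) <= (l * (2 + 4 * x)) ^+ k.+1.
Proof.
elim/ltn_ind: k x => k IH x kN x0.
(* This makes [h] a primitive of [h'], the bound of [transport_coef_le] at [y = 2 + 4 t]. The slope
   4 leaves the denominator [2 * k.+1], which absorbs the factor [k.+2] of the claim. *)
pose C := l ^+ k.+1 / (2 * k.+1%:R).
have k1 : 0 < k.+1%:R :> R by [].
have C0 : 0 <= C by rewrite divr_ge0 ?exprn_ge0 ?ltW// mulr_gt0.
pose h t := C * (2 + 4 * t) ^+ k.+1.
pose h' t := 2 * l ^+ k.+1 * (2 + 4 * t) ^+ k.
have hx : normc (u k x - u k 0) <= h x - h 0.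
  apply: (@normc_increment_le _ (u k) h h' 0 x (C * (k.+1%:R * (2 + 4 * x) ^+ k * 4)) x0).
  - exact: (lipschitzCS (fun _ _ => I) (uL kN)).
  - move=> s t; rewrite !in_itv/= => /andP[s0 sx] /andP[t0 tx].
    have e : `|(2 + 4 * s) ^+ k.+1 - (2 + 4 * t) ^+ k.+1| <=
        k.+1%:R * (2 + 4 * x) ^+ k * (4 * `|s - t|).
      have -> : 4 * `|s - t| = `|2 + 4 * s - (2 + 4 * t)|.
        have -> : 2 + 4 * s - (2 + 4 * t) = 4 * (s - t) by ring.
        by rewrite normrM (ger0_norm (_ : 0 <= 4 :> R)).
      by apply: ler_norm_subrXX; rewrite ger0_norm; lra.
    rewrite /h -mulrBr normrM (ger0_norm C0) (le_trans (ler_wpM2l C0 e))//.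
    by rewrite le_eqVlt; apply/orP; left; apply/eqP; ring.
  - move=> t _.
    have ht : is_derive t 1 (fun t : R => 2 + 4 * t) 4.
      by apply: is_derive_eq; rewrite /GRing.scale/=; ring.
    have -> : h = C \*: (fun t : R => 2 + 4 * t) ^+ k.+1.
      by apply/funext => z; rewrite /h /= exprfctE.
    have -> : h' t = C *: ((k.+1%:R * (2 + 4 * t) ^+ k.+1.-1) *: 4).
      rewrite /h' /C /GRing.scale/=.
      have -> : l ^+ k.+1 / (2 * k.+1%:R) * (k.+1%:R * (2 + 4 * t) ^+ k * 4) =
        2 * l ^+ k.+1 * (2 + 4 * t) ^+ k * (k.+1%:R / k.+1%:R).
        by rewrite invfM; field.
      by rewrite divff ?mulr1// gt_eqF.
    by have := is_deriveZ C (is_deriveX k.+1 ht).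
  - have := u' kN; apply: (ae_mono2 _ al) => t at_ ut.
    rewrite in_itv/= => /andP[t0 tx]; exists (- transport_coef (a ^~ t) (u ^~ t) k) => //.
    rewrite normcN; apply: transport_coef_le => //; [exact: ltW|lra|].
    by move=> j jk; apply: IH => //; [exact: ltn_trans kN|exact: ltW].
move: hx; rewrite u0// subr0 /h => hx.
have : normc (u k x) <= C * (2 + 4 * x) ^+ k.+1.
  by rewrite (le_trans hx)// gerBl mulr_ge0// exprn_ge0.
move=> ux; rewrite (le_trans (ler_wpM2l _ ux))//.
rewrite /C exprMn mulrA ler_wpM2r ?exprn_ge0//; first lra.
rewrite mulrA ler_pdivrMr ?mulr_gt0// mulrC ler_wpM2l ?exprn_ge0 ?(ltW l0)//.
by rewrite -natrM ler_nat mul2n -addnn addSnnS leq_addl.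
Qed.

End TransportSystem.
End TransportBounds.

(** * From a first integral to a center *)

Section FirstIntegral.
Context {R : realType}.
Local Notation mu := (@lebesgue_measure R).
Local Notation normc := (@Normc.normc R).
Local Notation half := (2^-1 : R).

Lemma sum_mulrB (K : pzRingType) n (f g h : nat -> K) :
  \sum_(k < n) f k * (g k - h k) = \sum_(k < n) f k * g k - \sum_(k < n) f k * h k.
Proof. by rewrite -sumrB; apply: eq_bigr => k _; rewrite mulrBr. Qed.

Lemma half_pow_ge0 n : 0 <= half ^+ n.
Proof. by rewrite exprn_ge0// invr_ge0. Qed.

Lemma cvg_half_pow : (half ^+ n) @[n --> \oo] --> (0 : R).
Proof. by apply: cvg_expr; rewrite ger0_norm ?invr_ge0// invf_lt1// ltr1n. Qed.

Lemma le_half_pow_limit (x y C : R) :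
  (forall n, x <= y + C * half ^+ n) -> x <= y.
Proof.
move=> xy; apply/ler_addgt0Pr => e e0.
have : (C * half ^+ n) @[n --> \oo] --> C * 0.
  by apply: cvgM; [exact: cvg_cst|exact: cvg_half_pow].
rewrite mulr0 => /cvgrPdist_lt /(_ _ e0)[n _ /(_ n (leqnn n))].
rewrite sub0r normrN => h; have := xy n; have := ler_norm (C * half ^+ n); lra.
Qed.

(** The intervals of radius [2 * C * half ^+ n] around [x n] are nested; the supremum of their left
    ends lies in all of them, which yields the limit together with its rate. *)
Lemma geometric_cauchy (x : nat -> R) (C : R) : 
  (forall n, `|x n.+1 - x n| <= C * half ^+ n) ->
  exists l, forall n, `|x n - l| <= 2 * C * half ^+ n.
Proof.
move=> xC; pose y n := x n - 2 * C * half ^+ n; pose z n := x n + 2 * C * half ^+ n.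
have C0 n : 0 <= C * half ^+ n by rewrite (le_trans _ (xC n)).
have ym n p : y n <= y (n + p)%N.
  elim: p => [|p IH]; rewrite ?addn0// addnS (le_trans IH)// /y exprS.
  have := xC (n + p)%N; rewrite ler_norml; lra.
have zm n p : z (n + p)%N <= z n.
  elim: p => [|p IH]; rewrite ?addn0// addnS (le_trans _ IH)// /z exprS.
  have := xC (n + p)%N; rewrite ler_norml; lra.
have yz n m : y n <= z m.
  rewrite (le_trans (ym n m))// (le_trans _ (zm m n))// addnC /y /z.
  by have := C0 (m + n)%N; lra.
exists (sup (range y)) => n.
have h1 : y n <= sup (range y).
  by apply: ub_le_sup; [exists (z 0%N) => _ [m _ <-]|exists n].
have h2 : sup (range y) <= z n.
  by apply: ge_sup; [exists (y 0%N), 0%N|move=> _ [m _ <-]].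
by rewrite ler_norml; move: h1 h2; rewrite /y /z; lra.
Qed.

Lemma geometric_cauchyC (x : nat -> R[i]) (C : R) :
  (forall n, normc (x n.+1 - x n) <= C * half ^+ n) ->
  exists l, forall n, normc (x n - l) <= 4 * C * half ^+ n.
Proof.
move=> xC.
have [|p pP] := @geometric_cauchy (fun n => complex.Re (x n)) C.
  by move=> n; rewrite -ReB (le_trans (Re_le_normc _)).
have [|q qP] := @geometric_cauchy (fun n => complex.Im (x n)) C.
  by move=> n; rewrite -ImB (le_trans (Im_le_normc _)).
exists (p +i* q) => n; rewrite (le_trans (normc_le_ReIm _))// ReB ImB/=.
by have := pP n; have := qP n; lra.
Qed.

(** * Solving [F(v, x) = r] for [v] *)

Section Inversion.
Variables (u : nat -> R -> R[i]) (c s : R) (r : R[i]).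
Hypothesis c0 : 0 <= c.
Hypothesis s0 : 0 <= s.
Hypothesis cs : c * s <= 8^-1.
Hypothesis rs : normc r <= s / 2.
Hypothesis uc : forall k x, k.+2%:R * normc (u k x) <= c ^+ k.+1.
Hypothesis uL : forall k x y, normc (u k x - u k y) <= c ^+ k.+1 * `|x - y|.

Let cs0 : 0 <= c * s. Proof. exact: mulr_ge0. Qed.
Let cs2 : 0 <= c * s <= 2^-1.
Proof. by rewrite cs0 (le_trans cs)// lef_pV2 ?posrE// ler_nat. Qed.

(** On the disc of radius [s] the nonlinear part of [F] thus has size at most [s / 4] and Lipschitz
    constant at most [1/4] in [z]. Together with [normc r <= s / 2] this keeps the iteration in the
    disc and makes it contract. *)
Let sum_cs n : \sum_(k < n) (c * s) ^+ k.+1 <= 4^-1.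
Proof. by rewrite (le_trans (geometric1_le n cs2))//; move: cs; lra. Qed.

Lemma coef_pow_le k x z : normc z <= s -> normc (u k x * z ^+ k.+2) <= s * (c * s) ^+ k.+1.
Proof.
move=> zs; rewrite Normc.normcM normcX.
apply: (@le_trans _ _ (c ^+ k.+1 * s ^+ k.+2)).
  apply: ler_pM; [exact: normc_ge0|exact/exprn_ge0/normc_ge0| |].
    rewrite (le_trans _ (uc k x))// ler_peMl ?normc_ge0// ler1n//.
  by rewrite lerXn2r ?nnegrE ?normc_ge0.
by rewrite [s ^+ k.+2]exprS exprMn mulrCA.
Qed.

(** The factor [k.+2] produced by a difference of powers is the one already present in the bound
    [uc]. *)
Lemma coef_pow_sub_le k x z w : normc z <= s -> normc w <= s ->
  normc (u k x * (z ^+ k.+2 - w ^+ k.+2)) <= (c * s) ^+ k.+1 * normc (z - w).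
Proof.
move=> zs ws; rewrite Normc.normcM.
rewrite (le_trans (ler_wpM2l (normc_ge0 _) (normc_subrXX k.+2 zs ws)))//.
rewrite !mulrA ler_wpM2r ?normc_ge0// (mulrC _ k.+2%:R) exprMn.
by rewrite ler_wpM2r ?exprn_ge0.
Qed.

Lemma coef_pow_lip k x y z w : normc z <= s -> normc w <= s ->
  normc (u k x * z ^+ k.+2 - u k y * w ^+ k.+2) <=
  (c * s) ^+ k.+1 * (s * `|x - y| + normc (z - w)).
Proof.
move=> zs ws.
have -> : u k x * z ^+ k.+2 - u k y * w ^+ k.+2 =
  (u k x - u k y) * z ^+ k.+2 + u k y * (z ^+ k.+2 - w ^+ k.+2) by ring.
rewrite (le_trans (le_normcD _ _))// [leRHS]mulrDr lerD ?coef_pow_sub_le//.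
rewrite Normc.normcM normcX.
apply: (@le_trans _ _ (c ^+ k.+1 * `|x - y| * s ^+ k.+2)); last first.
  by rewrite [s ^+ k.+2]exprS exprMn le_eqVlt; apply/orP; left; apply/eqP; ring.
apply: ler_pM; [exact: normc_ge0|exact/exprn_ge0/normc_ge0|exact: uL|].
by rewrite lerXn2r ?nnegrE ?normc_ge0.
Qed.

(* Successive approximations of the solution of F(v, x) = r, in which the series
   is cut at a growing order so that only finite sums occur. *)
Fixpoint inv_iter n (x : R) : R[i] :=
  if n is m.+1 then r - \sum_(k < m) u k x * inv_iter m x ^+ k.+2 else r.

Lemma inv_iter_le n x : normc (inv_iter n x) <= s.
Proof.
elim: n => [|n IH] /=; first by rewrite (le_trans rs)//; move: s0; lra.
rewrite (le_trans (le_normcB _ _))//.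
have : normc (\sum_(k < n) u k x * inv_iter n x ^+ k.+2) <= s * 4^-1.
  rewrite (le_trans (normc_sum _ _ _))//.
  apply: (@le_trans _ _ (\sum_(k < n) s * (c * s) ^+ k.+1)).
    by apply: ler_sum => k _; exact: coef_pow_le.
  by rewrite -mulr_sumr ler_wpM2l.
have := rs; have := s0; lra.
Qed.

Lemma inv_iter_lip n x y : normc (inv_iter n x - inv_iter n y) <= s * `|x - y|.
Proof.
have sxy : 0 <= s * `|x - y| by rewrite mulr_ge0.
elim: n => [|n IH] /=; first by rewrite subrr Normc.normc0.
rewrite opprB addrC addrA subrK -sumrB.
rewrite (le_trans (normc_sum _ _ _))//.
apply: (@le_trans _ _ (\sum_(k < n) (c * s) ^+ k.+1 * (2 * (s * `|x - y|)))).
  apply: ler_sum => k _.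
  rewrite (le_trans (coef_pow_lip _ _ _ (inv_iter_le _ _) (inv_iter_le _ _)))//.
  rewrite ler_wpM2l ?exprn_ge0// (distrC y x) normcB; lra.
rewrite -mulr_suml.
have := ler_wpM2r (_ : 0 <= 2 * (s * `|x - y|)) (sum_cs n); lra.
Qed.

Lemma inv_iter_step n x : normc (inv_iter n.+1 x - inv_iter n x) <= s * half ^+ n.
Proof.
elim: n => [|n IH]; first by rewrite /= big_ord0 subr0 subrr Normc.normc0 mulr1.
have -> : inv_iter n.+2 x - inv_iter n.+1 x =
    - (u n x * inv_iter n.+1 x ^+ n.+2)
    - \sum_(k < n) u k x * (inv_iter n.+1 x ^+ k.+2 - inv_iter n x ^+ k.+2).
  rewrite [inv_iter n.+2 x]/= [X in _ - X = _]/= big_ord_recr/=.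
  rewrite (sum_mulrB n (u ^~ x) (fun k => inv_iter n.+1 x ^+ k.+2)
    (fun k => inv_iter n x ^+ k.+2)).
  by rewrite [in RHS]/=; ring.
rewrite (le_trans (le_normcB _ _))// normcN.
have h1 := coef_pow_le n x (inv_iter_le n.+1 x).
have h2 : normc (\sum_(k < n) u k x * (inv_iter n.+1 x ^+ k.+2 - inv_iter n x ^+ k.+2))
    <= 4^-1 * (s * half ^+ n).
  rewrite (le_trans (normc_sum _ _ _))//.
  apply: (@le_trans _ _ (\sum_(k < n) (c * s) ^+ k.+1 * (s * half ^+ n))).
    apply: ler_sum => k _.
    rewrite (le_trans (coef_pow_sub_le _ _ (inv_iter_le _ _) (inv_iter_le _ _)))//.
    by rewrite ler_wpM2l ?exprn_ge0.
  by rewrite -mulr_suml ler_wpM2r ?mulr_ge0 ?half_pow_ge0.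
have h3 : (c * s) ^+ n.+1 <= 4^-1 * half ^+ n.
  rewrite exprS ler_pM ?exprn_ge0//; first by move: cs; lra.
  by rewrite lerXn2r ?nnegrE ?invr_ge0//; move: cs; lra.
have := mulr_ge0 s0 (half_pow_ge0 n); have := ler_wpM2l s0 h3; rewrite [half ^+ n.+1]exprS; lra.
Qed.

(** [F(v, x) = r] is expressed through partial sums with a rate. In the constant 3, contraction of
    [v - inv_iter n] contributes 1 and the distance of [inv_iter n.+1] from its limit contributes
    2. *)
Lemma inverse_exists : exists v : R -> R[i],
  [/\ forall x, normc (v x) <= s, forall x y, normc (v x - v y) <= s * `|x - y| &
   forall n x, normc (v x + \sum_(k < n) u k x * v x ^+ k.+2 - r) <= 3 * s * half ^+ n].
Proof.
have /choice[v vP] : forall x, exists l, forall n,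
    normc (inv_iter n x - l) <= 4 * s * half ^+ n.
  by move=> x; apply: geometric_cauchyC => n; exact: inv_iter_step.
have vs x : normc (v x) <= s.
  apply: (@le_half_pow_limit _ _ (4 * s)) => n.
  have := le_normc_sub (v x) (inv_iter n x); rewrite normcB.
  by have := vP x n; have := inv_iter_le n x; lra.
exists v; split => //.
  move=> x y; apply: (@le_half_pow_limit _ _ (8 * s)) => n.
  have -> : v x - v y = (inv_iter n x - inv_iter n y) -
    ((inv_iter n x - v x) - (inv_iter n y - v y)) by ring.
  rewrite (le_trans (le_normcB _ _))//.
  have := le_normcB (inv_iter n x - v x) (inv_iter n y - v y).
  have := vP x n; have := vP y n; have := inv_iter_lip n x y; lra.
move=> n x.
have -> : v x + \sum_(k < n) u k x * v x ^+ k.+2 - r =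
  \sum_(k < n) u k x * (v x ^+ k.+2 - inv_iter n x ^+ k.+2) - (inv_iter n.+1 x - v x).
  rewrite (sum_mulrB n (u ^~ x) (fun k => v x ^+ k.+2) (fun k => inv_iter n x ^+ k.+2)) /=.
  by ring.
rewrite (le_trans (le_normcB _ _))//.
have := vP x n.+1; rewrite exprS.
have : normc (\sum_(k < n) u k x * (v x ^+ k.+2 - inv_iter n x ^+ k.+2)) <=
    4^-1 * (4 * s * half ^+ n).
  rewrite (le_trans (normc_sum _ _ _))//.
  apply: (@le_trans _ _ (\sum_(k < n) (c * s) ^+ k.+1 * (4 * s * half ^+ n))).
    apply: ler_sum => k _; rewrite (le_trans (coef_pow_sub_le _ _ (vs _) (inv_iter_le _ _)))//.
    by rewrite ler_wpM2l ?exprn_ge0// normcB.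
  by rewrite -mulr_suml ler_wpM2r ?mulr_ge0 ?half_pow_ge0.
lra.
Qed.

End Inversion.
End FirstIntegral.

(** * Differentiating the implicit function *)

Section SolutionFromIntegral.
Context {R : realType}.
Local Notation mu := (@lebesgue_measure R).
Local Notation normc := (@Normc.normc R).
Local Notation half := (2^-1 : R).

(** With [c * s <= 1/8] the remainder still decays after its monomials are counted, since
    [n ^ 2 <= 4 ^ n]. *)
Lemma natr_half_pow_le n : n%:R ^+ 2 * (8^-1 : R) ^+ n <= half ^+ n.
Proof.
have h : n%:R <= 2 ^+ n :> R by rewrite -natrX ler_nat ltnW// ltn_expl.
have -> : half ^+ n = (2 ^+ n) ^+ 2 * (8^-1 : R) ^+ n.
  rewrite -exprM mulnC exprM -exprMn; congr (_ ^+ n); by field.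
by rewrite ler_wpM2r ?exprn_ge0 ?invr_ge0// lerXn2r ?nnegrE.
Qed.

Lemma is_deriveC_integral (u : nat -> R -> R[i]) (v : R -> R[i]) N (x : R)
    (d : nat -> R[i]) v' :
  (forall k, (k < N)%N -> is_deriveC (u k) x (d k)) -> is_deriveC v x v' ->
  is_deriveC (fun t => v t + \sum_(k < N) u k t * v t ^+ k.+2) x
   ((1 + \sum_(k < N) k.+2%:R * u k x * v x ^+ k.+1) * v' + \sum_(k < N) d k * v x ^+ k.+2).
Proof.
move=> ud vd.
have h : is_deriveC (fun t => v t + \sum_(k < N) u k t * v t ^+ k.+2) x
    (v' + \sum_(k < N) (d k * v x ^+ k.+2 + u k x * (k.+2%:R * v x ^+ k.+1 * v'))).
  apply: is_deriveCD => //.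
  apply: (@is_deriveC_sum _ _ (fun k t => u k t * v t ^+ k.+2)
    (fun k => d k * v x ^+ k.+2 + u k x * (k.+2%:R * v x ^+ k.+1 * v'))) => k kN.
  by apply: is_deriveCM; [exact: ud|exact: is_deriveCX].
apply: is_deriveC_eq h _; rewrite big_split/= mulrDl mul1r -addrA; congr (_ + _).
rewrite addrC; congr (_ + _); rewrite mulr_suml; apply: eq_bigr => k _; ring.
Qed.

Variables (a u : nat -> R -> R[i]) (c s : R) (r : R[i]).
Hypothesis c0 : 0 <= c.
Hypothesis s0 : 0 <= s.
Hypothesis cs : c * s <= 8^-1.
Hypothesis rs : normc r <= s / 2.
Hypothesis uc : forall k x, k.+2%:R * normc (u k x) <= c ^+ k.+1.
Hypothesis uL : forall k x y, normc (u k x - u k y) <= c ^+ k.+1 * `|x - y|.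
Hypothesis ac : {ae mu, forall x, forall i, normc (a i x) <= c ^+ i.+1}.
Hypothesis u' : forall k,
  {ae mu, forall x, is_deriveC (u k) x (- transport_coef (a ^~ x) (u ^~ x) k)}.

Let cs0 : 0 <= c * s. Proof. exact: mulr_ge0. Qed.
Let cs2 : 0 <= c * s <= 2^-1.
Proof. by rewrite cs0 (le_trans cs)// lef_pV2 ?posrE// ler_nat. Qed.

(** Since [F = r], a partial sum is a constant minus a tail, and the terms of the tail have
    geometrically small Lipschitz constants. The tail is cut at [n + m], with an error that
    disappears as [m] grows. *)
Lemma partial_integral_lip (v : R -> R[i]) n x y :
  (forall x, normc (v x) <= s) -> (forall x y, normc (v x - v y) <= s * `|x - y|) ->
  (forall n x, normc (v x + \sum_(k < n) u k x * v x ^+ k.+2 - r) <= 3 * s * half ^+ n) ->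
  normc ((v x + \sum_(k < n) u k x * v x ^+ k.+2) -
         (v y + \sum_(k < n) u k y * v y ^+ k.+2)) <= s * half ^+ n * `|x - y|.
Proof.
move=> vs vL vF; pose F m x := v x + \sum_(k < m) u k x * v x ^+ k.+2.
rewrite -/(F n x) -/(F n y); apply: (@le_half_pow_limit _ _ _ (6 * s)) => m.
pose T x := \sum_(n <= k < n + m) u k x * v x ^+ k.+2.
have FT z : F (n + m)%N z = F n z + T z.
  rewrite /F /T -!(big_mkord xpredT (fun k => u k z * v z ^+ k.+2)).
  by rewrite (big_cat_nat (n := n)) ?leq_addr//= addrA.
have -> : F n x - F n y = (F (n + m)%N x - r) - (F (n + m)%N y - r) - (T x - T y).
  by rewrite !FT; move: (F n x) (F n y) (T x) (T y) => A1 A2 A3 A4; ring.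
have h1 := vF (n + m)%N x; have h2 := vF (n + m)%N y.
have h3 : half ^+ (n + m) <= half ^+ m.
  by rewrite ler_wiXn2l ?invr_ge0 ?leq_addl// invf_le1// ler1n.
have h4 : normc (T x - T y) <= s * half ^+ n * `|x - y|.
  rewrite /T -sumrB (le_trans (normc_sum _ _ _))//.
  apply: (@le_trans _ _ (\sum_(n <= k < n + m) (c * s) ^+ k * (c * s * (2 * (s * `|x - y|))))).
    apply: ler_sum => k _.
    rewrite (le_trans (coef_pow_lip s0 uc uL _ _ _ (vs x) (vs y)))//.
    rewrite mulrA -exprSr ler_wpM2l ?exprn_ge0//; have := vL x y; lra.
  rewrite -mulr_suml.
  have h5 := geometric_le n (n + m)%N cs2.
  have h6 : (c * s) ^+ n <= half ^+ n.
    by move: cs2 => /andP[_ ?]; rewrite lerXn2r ?nnegrE ?invr_ge0.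
  have sxy : 0 <= s * `|x - y| by rewrite mulr_ge0.
  have h7 : c * s * (2 * (s * `|x - y|)) <= 4^-1 * (s * `|x - y|).
    rewrite mulrA ler_wpM2r//; move: cs; lra.
  apply: (@le_trans _ _ (2 * half ^+ n * (4^-1 * (s * `|x - y|)))); last first.
    have := mulr_ge0 (half_pow_ge0 n) sxy; lra.
  apply: ler_pM => //; [by apply: sumr_ge0 => k _; rewrite exprn_ge0|by rewrite !mulr_ge0|].
  by rewrite (le_trans h5)// ler_wpM2l.
have := le_normcB ((F (n + m)%N x - r) - (F (n + m)%N y - r)) (T x - T y).
have := le_normcB (F (n + m)%N x - r) (F (n + m)%N y - r).
move: (ler_wpM2l s0 h3) h1 h2 h4; rewrite /F; lra.
Qed.

Lemma solution_of_integral :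
  (forall k, u k 0 = 0) -> (forall k, u k (pi *+ 2) = 0) ->
  exists2 v, is_solution a r v & v (pi *+ 2) = r.
Proof.
move=> u0 uT.
have [v [vs vL vF]] := inverse_exists c0 s0 cs rs uc uL.
have v_fix x : (forall k, u k x = 0) -> v x = r.
  move=> ux; apply/eqP; rewrite -subr_eq0; apply/eqP/Normc.eq0_normc/eqP.
  rewrite eq_le normc_ge0 andbT; apply: (@le_half_pow_limit _ _ _ (3 * s)) => n.
  have := vF n x; rewrite big1 ?addr0 ?add0r// => k _.
  by rewrite ux mul0r.
exists v; last exact: v_fix.
have vlip A : lipschitzC A v by exists s => x y _ _.
split; [exact: vlip|exact: v_fix|].
have va := lipschitzC_ae_derivable (vlip setT).
have ua := ae_foralln u'.
have h := ae_mono2 (fun x p q => conj p q) ac ua.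
apply: ae_mono2 h va => x [ax ux] vx _.
split; first by have [] := is_deriveC_deriveC vx.
set v' := deriveC v x in vx *.
pose P n := 1 + \sum_(k < n) k.+2%:R * u k x * v x ^+ k.+1.
pose Q n := \sum_(i < n) a i x * v x ^+ i.+2.
pose d k := - transport_coef (a ^~ x) (u ^~ x) k.
(* The derivative of the partial sum is [P n * (v' - Q n)] plus the remainder. Both it and the
   remainder are of order [half ^+ n], and [P n], the derivative of [F] in [t], stays at least [3/4]
   in modulus. *)
have main n : normc (Q n - v') <= 4 * s * half ^+ n.
  have D := is_deriveC_integral (fun k _ => ux k) vx (N := n).
  have hD := is_deriveC_normc_le D (fun y => partial_integral_lip n x y vs vL vF).
  have hE := transport_identity (v x) (fun (k : nat) (_ : (k < n)%N) => erefl (d k)).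
  have hR : normc (transport_rest (a ^~ x) (u ^~ x) n (v x)) <= s * half ^+ n.
    rewrite (le_trans (transport_rest_le c0 s0 _ _ _ (vs x)))//.
    - by move: cs; lra.
    - rewrite mulrCA ler_wpM2l//.
      rewrite (le_trans _ (natr_half_pow_le n))// ler_wpM2l ?exprn_ge0//.
      rewrite (le_trans (_ : _ <= (c * s) ^+ n))//.
        by rewrite exprS ler_piMl ?exprn_ge0//; move: cs; lra.
      by rewrite lerXn2r ?nnegrE ?invr_ge0.
  have hP : 3 / 4 <= normc (P n).
    have : normc (\sum_(k < n) k.+2%:R * u k x * v x ^+ k.+1) <= 4^-1.
      rewrite (le_trans (normc_sum _ _ _))//.
      apply: (@le_trans _ _ (\sum_(k < n) (c * s) ^+ k.+1)).
        apply: ler_sum => k _; rewrite Normc.normcM normcX Normc.normcM normc_nat exprMn.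
        apply: ler_pM; [by rewrite mulr_ge0 ?normc_ge0|exact/exprn_ge0/normc_ge0|exact: uc|].
        by rewrite lerXn2r ?nnegrE ?normc_ge0.
      by rewrite (le_trans (geometric1_le n cs2))//; move: cs; lra.
    have := le_normc_sub 1 (- \sum_(k < n) k.+2%:R * u k x * v x ^+ k.+1).
    by rewrite normcN opprK Normc.normc1 /P; lra.
  have hQ : normc (P n * (v' - Q n)) <= 3 * s * half ^+ n.
    have -> : P n * (v' - Q n) =
        (P n * v' + \sum_(k < n) d k * v x ^+ k.+2) - transport_rest (a ^~ x) (u ^~ x) n (v x).
      by rewrite -hE /P /Q; ring.
    rewrite (le_trans (le_normcB _ _))//.
    by move: hD hR; rewrite /P /d; lra.
  have hQ' : 3 / 4 * normc (v' - Q n) <= 3 * s * half ^+ n.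
    by rewrite (le_trans _ hQ)// Normc.normcM ler_wpM2r ?normc_ge0.
  rewrite normcB; lra.
have cv : (4 * s * half ^+ n) @[n --> \oo] --> (0 : R).
  by rewrite -[X in _ --> X](mulr0 (4 * s)); apply: cvgM; [exact: cvg_cst|exact: cvg_half_pow].
rewrite /cvgC; apply: (squeeze_cvgr _ (cvg_cst 0) cv).
by apply: nearW => n; rewrite normc_ge0 main.
Qed.

End SolutionFromIntegral.

(** * Uniform bounds for periodic coefficients *)

Section CenterOfIntegral.
Context {R : realType}.
Local Notation mu := (@lebesgue_measure R).
Local Notation normc := (@Normc.normc R).

Lemma periodic_fundamental (T x : R) : 0 < T -> exists2 z, 0 <= z <= T &
  forall (U : Type) (f : R -> U), (forall y, f (y + T) = f y) -> f x = f z.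
Proof.
move=> T0; pose m := Num.floor (x / T); exists (x - m%:~R * T).
  have := floor_itv (x / T); rewrite -/m => /andP[m1 m2].
  have h1 : m%:~R * T <= x by rewrite -ler_pdivlMr.
  have h2 : x < (m%:~R + 1) * T by rewrite -ltr_pdivrMr// -intrD1.
  by apply/andP; split; lra.
move=> U f fT.
have fn n y : f (y + n%:R * T) = f y.
  elim: n => [|n IH]; first by rewrite mul0r addr0.
  by rewrite -addn1 natrD mulrDl mul1r addrA fT IH.
case: m => n.
  by rewrite -(fn n (x - _)) subrK.
by rewrite NegzE mulrNz mulNr opprK fn.
Qed.

Variables (a u : nat -> R -> R[i]) (l : R).
Local Notation T := (pi *+ 2 : R).
Hypothesis l0 : 0 < l.
Hypothesis al : {ae mu, forall x, forall i, normc (a i x) <= l ^+ i.+1}.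
Variable N : nat.
Hypothesis uT : forall k, (k < N)%N -> forall x, u k (x + T) = u k x.
Hypothesis uL : forall k, (k < N)%N -> lipschitzC setT (u k).
Hypothesis u0 : forall k, (k < N)%N -> u k 0 = 0.
Hypothesis u' : forall k, (k < N)%N ->
  {ae mu, forall x, is_deriveC (u k) x (- transport_coef (a ^~ x) (u ^~ x) k)}.

Lemma two_pi_gt0 : 0 < T. Proof. by rewrite mulrn_wgt0// pi_gt0. Qed.

(** The ratio in [transport_bound] grows with [x], but periodicity allows [x] to be replaced by a
    point of [[0, T]]. *)
Lemma periodic_transport_bound k (x : R) : (k < N)%N ->
  k.+2%:R * normc (u k x) <= (l * (2 + 4 * T)) ^+ k.+1.
Proof.
move=> kN; have [z /andP[z0 zT] zP] := periodic_fundamental x two_pi_gt0.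
rewrite (zP _ (u k) (uT kN)) (le_trans (transport_bound l0 al uL u0 u' kN z0))//.
rewrite lerXn2r ?nnegrE ?mulr_ge0 ?(ltW l0)//; [lra|have := two_pi_gt0; lra|].
by rewrite ler_wpM2l ?(ltW l0)//; lra.
Qed.

(** The index [k = N] is included: this coefficient involves only the [u j] with [j < N], so it
    bounds the derivative of the next function before that function is constructed. *)
Lemma ae_periodic_coef_bound k : (k <= N)%N ->
  {ae mu, forall x, normc (transport_coef (a ^~ x) (u ^~ x) k) <= (l * (2 + 4 * T)) ^+ k.+1}.
Proof.
move=> kN; have T0 := two_pi_gt0; apply: ae_mono al => x ax.
have h : normc (transport_coef (a ^~ x) (u ^~ x) k) <= 2 * l ^+ k.+1 * (2 + 4 * T) ^+ k.
  apply: transport_coef_le => //; [exact: ltW|lra|].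
  by move=> j jk; apply: periodic_transport_bound; exact: leq_trans kN.
rewrite (le_trans h)// exprMn [(2 + _) ^+ k.+1]exprS mulrA (mulrC 2).
rewrite ler_wpM2r ?exprn_ge0//; first lra.
by rewrite ler_wpM2l ?exprn_ge0 ?(ltW l0)//; lra.
Qed.

Lemma periodic_transport_lip k x y : (k < N)%N ->
  normc (u k x - u k y) <= (l * (2 + 4 * T)) ^+ k.+1 * `|x - y|.
Proof.
move=> kN.
have H z w : z <= w -> normc (u k w - u k z) <= (l * (2 + 4 * T)) ^+ k.+1 * (w - z).
  move=> zw; apply: normc_increment_leM => //.
    exact: (lipschitzCS (fun _ _ => I) (uL kN)).
  apply: ae_mono2 (u' kN) (ae_periodic_coef_bound (ltnW kN)) => t u't ct _.
  by exists (- transport_coef (a ^~ t) (u ^~ t) k); rewrite ?normcN.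
have [xy|/ltW yx] := leP x y; last first.
  by rewrite ger0_norm ?subr_ge0// H.
by rewrite normcB distrC ger0_norm ?subr_ge0// H.
Qed.

End CenterOfIntegral.

Section Sufficiency.
Context {R : realType}.
Local Notation mu := (@lebesgue_measure R).
Local Notation normc := (@Normc.normc R).

Lemma center_of_first_integral (a u : nat -> R -> R[i]) : in_X a ->
  (forall k, periodic (u k) (pi *+ 2) /\ lipschitzC setT (u k)) ->
  (forall k, u k 0 = 0) ->
  (forall n, {ae mu, forall x, equation_series a x n =
     fps_opp (fps_div (numerator_series u x) (denominator_series u x)) n}) ->
  in_center_set a.
Proof.
move=> aX upl u0 us.
have [l l0 al] := in_X_ae_bound aX.
have u' k : {ae mu, forall x, is_deriveC (u k) x (- transport_coef (a ^~ x) (u ^~ x) k)}.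
  have du := lipschitzC_ae_derivable (upl k).2.
  apply: ae_mono2 (ae_foralln us) du => x /series_transportP e du.
  exact: is_deriveC_eq du (e k).
have uT k x : u k (x + pi *+ 2) = u k x by case: (upl k) => + _; apply.
pose c := l * (2 + 4 * (pi *+ 2)).
have T0 := @two_pi_gt0 R.
have c0 : 0 < c by rewrite mulr_gt0//; lra.
have lc : l <= c by rewrite ler_peMr ?ltW//; lra.
pose s := (8 * c)^-1.
have s0 : 0 < s by rewrite invr_gt0 mulr_gt0.
have cs : c * s = 8^-1 by rewrite /s invfM mulrCA divff ?mulr1// gt_eqF.
exists (s / 2) => [|r rs]; first by rewrite divr_gt0.
have uc k x : k.+2%:R * normc (u k x) <= c ^+ k.+1.
  exact: (@periodic_transport_bound _ a u l l0 al k.+1 (fun k _ => uT k)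
    (fun k _ => (upl k).2) (fun k _ => u0 k) (fun k _ => u' k)).
have uL k x y : normc (u k x - u k y) <= c ^+ k.+1 * `|x - y|.
  exact: (@periodic_transport_lip _ a u l l0 al k.+1 (fun k _ => uT k)
    (fun k _ => (upl k).2) (fun k _ => u0 k) (fun k _ => u' k)).
apply: (@solution_of_integral _ a u c s r) => //.
- exact: ltW.
- exact: ltW.
- by rewrite cs.
- exact: ltW.
- apply: ae_mono al => x ax i; rewrite (le_trans (ax i))//.
  by rewrite lerXn2r ?nnegrE ?(ltW l0) ?(ltW c0).
- by move=> k; rewrite -[pi *+ 2]add0r uT.
Qed.

End Sufficiency.

(** * From a center to a first integral *)

Section Necessity.
Context {R : realType}.
Local Notation mu := (@lebesgue_measure R).
Local Notation normc := (@Normc.normc R).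
Local Notation T := (pi *+ 2 : R).

Lemma power_series_tail (a : nat -> R[i]) (l s : R) z d n : 0 <= l -> 0 <= s ->
  l * s <= 2^-1 -> (forall i, normc (a i) <= l ^+ i.+1) -> normc z <= s ->
  cvgC (fun n => \sum_(i < n) a i * z ^+ i.+2) d ->
  normc (d - \sum_(i < n) a i * z ^+ i.+2) <= 2 * s * (l * s) ^+ n.+1.
Proof.
move=> l0 s0 ls al zs cv; apply: (@cvgC_normc_le _ _ _ _ _ n cv) => m nm.
have ls0 : 0 <= l * s by rewrite mulr_ge0.
have -> : \sum_(i < m) a i * z ^+ i.+2 - \sum_(i < n) a i * z ^+ i.+2 =
    \sum_(n <= i < m) a i * z ^+ i.+2.
  rewrite -!(big_mkord xpredT (fun i => a i * z ^+ i.+2)).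
  by rewrite (big_cat_nat (n := n) (p := m))//= addrAC subrr add0r.
rewrite (le_trans (normc_sum _ _ _))//.
apply: (@le_trans _ _ (\sum_(n <= i < m) (l * s) ^+ i * (s * (l * s)))).
  apply: ler_sum => i _; rewrite Normc.normcM normcX.
  have -> : (l * s) ^+ i * (s * (l * s)) = l ^+ i.+1 * s ^+ i.+2.
    by rewrite exprMn [l ^+ i.+1]exprS [s ^+ i.+2]exprS [s ^+ i.+1]exprS; ring.
  apply: ler_pM => //; [exact: normc_ge0|exact/exprn_ge0/normc_ge0|].
  by rewrite lerXn2r ?nnegrE ?normc_ge0.
rewrite -mulr_suml exprS.
have -> : 2 * s * (l * s * (l * s) ^+ n) = 2 * (l * s) ^+ n * (s * (l * s)) by ring.
rewrite ler_wpM2r ?mulr_ge0// geometric_le// ls0//.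
Qed.

(** Continuation up to the first time [t] at which [normc (v t)] reaches [s = 2 * normc r]. Before
    [t] the derivative is at most [2 * s * (l * s)], so over one period [v] moves by less than
    [s / 2 = normc r] and cannot have reached [s]. *)
Lemma solution_le (a : nat -> R -> R[i]) (l : R) r v : 0 < l ->
  {ae mu, forall x, forall i, normc (a i x) <= l ^+ i.+1} ->
  is_solution a r v -> r != 0 -> l * (2 * normc r) <= 2^-1 ->
  4 * (l * (2 * normc r)) * T < 1 ->
  forall x, x \in `[0, T] -> normc (v x) <= 2 * normc r.
Proof.
move=> l0 al [[K vK] v0 vs] r0 ls lsT x xT.
have [s sE] : exists s, s = 2 * normc r by exists (2 * normc r).
rewrite -sE in ls lsT *.
have rs : 0 < normc r.
  rewrite lt_def normc_ge0 andbT; apply: contra r0 => /eqP h.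
  by apply/eqP/Normc.eq0_normc.
have s0 : 0 < s by rewrite sE mulr_gt0.
have ls0 : 0 < l * s by rewrite mulr_gt0.
rewrite leNgt; apply/negP => sx.
pose A := [set y : R | y \in `[0, T] /\ s <= normc (v y)].
have hA : has_inf A.
  split; first by exists x; split => //; exact: ltW.
  by exists 0 => y [+ _]; rewrite in_itv/= => /andP[].
pose t := inf A.
have t0 : 0 <= t by apply: lb_le_inf; [exact: hA.1|move=> y [+ _]; rewrite in_itv/= => /andP[]].
have tx : t <= x by apply: ge_inf; [exact: hA.2|split => //; exact: ltW].
have tT : t <= T by rewrite (le_trans tx)//; move: xT; rewrite in_itv/= => /andP[].
have tI : t \in `[0, T] by rewrite in_itv/= t0.
(* The infimum belongs to [A], by the Lipschitz continuity of [v]. *)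
have st : s <= normc (v t).
  apply/ler_addgt0Pr => e e0.
  have e'0 : 0 < e / (`|K| + 1) by rewrite divr_gt0// ltr_wpDl.
  have [y [yT sy] yt] := inf_adherent e'0 hA.
  have ty : t <= y by apply: ge_inf; [exact: hA.2|split].
  have := vK y t yT tI; have := le_normc_sub (v y) (v t).
  have : K * `|y - t| <= e.
    rewrite ger0_norm ?subr_ge0//.
    have : (`|K| + 1) * (y - t) <= e.
      by rewrite mulrC -ler_pdivlMr ?ltr_wpDl// lerBlDl ltW.
    apply: le_trans; rewrite ler_wpM2r ?subr_ge0//.
    by rewrite (le_trans (ler_norm _))// lerDl.
  lra.
have vlip : lipschitzC `[0, t] v.
  apply: (@lipschitzCS _ _ `[0, T]%classic) => [y|]; last by exists K.
  by rewrite /= !in_itv/= => /andP[-> /le_trans]; apply.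
have h : normc (v t - v 0) <= 2 * s * (l * s) * (t - 0).
  apply: normc_increment_leM => //.
  apply: ae_mono2 al vs => y ay vy yt.
  have yT : y \in `[0, T].
    by move: yt; rewrite !in_itv/= => /andP[y0 yt]; rewrite ltW//= (le_trans (ltW yt)).
  have [dv cv] := vy yT; exists (deriveC v y); first exact: derivableC_is_deriveC.
  have ys : normc (v y) <= s.
    rewrite leNgt; apply/negP => sy.
    have : t <= y by apply: ge_inf; [exact: hA.2|split => //; exact: ltW].
    by rewrite leNgt; move: yt; rewrite in_itv/= => /andP[_ ->].
  have := @power_series_tail (a ^~ y) l s (v y) _ 0%N (ltW l0) (ltW s0) ls ay ys cv.
  by rewrite big_ord0 subr0 expr1.
have := le_normc_sub (v t) (v 0); rewrite v0.
have : 2 * s * (l * s) * (t - 0) < s / 2.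
  rewrite subr0 (@le_lt_trans _ _ (2 * s * (l * s) * T))//.
    by rewrite ler_wpM2l// mulr_ge0 ?(ltW ls0)// mulr_ge0 ?(ltW s0).
  have := ltr_pM2l s0 (4 * (l * s) * T) 1; rewrite lsT; lra.
move: h st; rewrite v0; lra.
Qed.

(** * The value of [u_n] after one period *)

Section Monodromy.
Variables (a u : nat -> R -> R[i]) (l : R) (N : nat).
Hypothesis l0 : 0 < l.
Hypothesis al : {ae mu, forall x, forall i, normc (a i x) <= l ^+ i.+1}.
Hypothesis uL : forall k, (k < N.+1)%N -> lipschitzC setT (u k).
Hypothesis u0 : forall k, (k < N.+1)%N -> u k 0 = 0.
Hypothesis u' : forall k, (k < N.+1)%N ->
  {ae mu, forall x, is_deriveC (u k) x (- transport_coef (a ^~ x) (u ^~ x) k)}.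
Hypothesis uT : forall k, (k < N)%N -> u k T = 0.

Let c := l * (2 + 4 * T).
(** The growth bound [M * T] below, taken at [s = 2 * rho] and divided by [rho ^+ N.+2], equals
    [C * rho]. *)
Let C := (4 + N.+1%:R ^+ 2) * 2 * (2 * c) ^+ N.+2 * T.

Lemma monodromy_coef_le (rho : R) (v : R -> R[i]) : 0 < rho ->
  c * (2 * rho) <= 8^-1 -> 4 * (l * (2 * rho)) * T < 1 ->
  is_solution a rho%:C v -> v T = rho%:C -> normc (u N T) <= C * rho.
Proof.
move=> rho0 crho lrho vsol vT.
have T0 := @two_pi_gt0 R.
have nr : normc rho%:C = rho by rewrite normc_real gtr0_norm.
pose s := 2 * rho.
have s0 : 0 < s by rewrite mulr_gt0.
have lc : l <= c by rewrite ler_peMr ?ltW//; lra.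
have c0 : 0 < c by rewrite (lt_le_trans l0).
have ls : l * s <= 2^-1.
  by rewrite (@le_trans _ _ (c * s)) ?ler_wpM2r ?(ltW s0)//; move: crho; rewrite /s; lra.
have cs2 : 0 <= c * s <= 2^-1.
  by rewrite mulr_ge0 ?ltW//=; move: crho; rewrite /s; lra.
have vs x : x \in `[0, T] -> normc (v x) <= s.
  move=> xT; rewrite /s -nr.
  apply: (solution_le l0 al vsol); rewrite ?nr//.
  by apply/eqP => /(congr1 normc); rewrite nr Normc.normc0; apply/eqP; rewrite gt_eqF.
pose F x := v x + \sum_(k < N.+1) u k x * v x ^+ k.+2.
(* The 4 is the bound 2 on the derivative of [F] in [t] times the factor 2 of the geometric tail of
   the equation; the square counts the monomials of the remainder. *)
pose M := (4 + N.+1%:R ^+ 2) * (s * (c * s) ^+ N.+2).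
have [vlip v0 vder] := vsol.
have vb : blipschitz `[0, T] v := lipschitzC_blipschitz vlip.
have FL : lipschitzC `[0, T] F.
  apply: (blipschitzD vb _).1.
  apply: (@blipschitz_sum _ _ _ (fun k t => u k t * v t ^+ k.+2)) => k kN; apply: blipschitzM.
    exact/lipschitzC_blipschitz/(lipschitzCS (fun _ _ => I) (uL kN)).
  exact: blipschitzX.
have hF : normc (F T - F 0) <= M * (T - 0).
  apply: normc_increment_leM => //; first exact: ltW.
  have ua : {ae mu, forall x, forall k, (k < N.+1)%N ->
      is_deriveC (u k) x (- transport_coef (a ^~ x) (u ^~ x) k)}.
    apply: ae_foralln => k; have [kN|kN] := ltnP k N.+1; last exact: aeW.
    by apply: ae_mono (u' kN).
  have h := ae_mono2 (fun x p q => conj p q) al ua.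
  apply: ae_mono2 h vder => x [ax ux] vx xT'.
  have xT : x \in `[0, T] by exact: subset_itv_oo_cc xT'.
  have [dv cv] := vx xT; have {}dv := derivableC_is_deriveC dv.
  set v' := deriveC v x in dv cv.
  have x0 : 0 <= x by move: xT; rewrite in_itv/= => /andP[].
  have uc k : (k < N.+1)%N -> k.+2%:R * normc (u k x) <= c ^+ k.+1.
    move=> kN; rewrite (le_trans (transport_bound l0 al uL u0 u' kN x0))//.
    rewrite lerXn2r ?nnegrE ?mulr_ge0 ?(ltW l0)//; [lra|lra|].
    by rewrite /c ler_wpM2l ?(ltW l0)//; move: xT; rewrite in_itv/= => /andP[_]; lra.
  have hD := is_deriveC_integral ux dv; eexists; first exact: hD.
  set d := (X in \sum_(k < N.+1) X k * _).
  have hE := transport_identity (v x) (fun (k : nat) (_ : (k < N.+1)%N) =>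
    erefl (- transport_coef (a ^~ x) (u ^~ x) k)).
  have hR : normc (transport_rest (a ^~ x) (u ^~ x) N.+1 (v x)) <=
      N.+1%:R ^+ 2 * (s * (c * s) ^+ N.+2).
    apply: transport_rest_le; rewrite ?(ltW c0) ?(ltW s0)//; last exact: vs.
      by move: cs2; lra.
    by move=> i; rewrite (le_trans (ax i))// lerXn2r ?nnegrE ?(ltW l0) ?(ltW c0).
  have hV := power_series_tail N.+1 (ltW l0) (ltW s0) ls ax (vs x xT) cv.
  pose P := 1 + \sum_(k < N.+1) k.+2%:R * u k x * v x ^+ k.+1.
  have hP : normc P <= 2.
    rewrite (le_trans (le_normcD _ _))// Normc.normc1 -[2]/(1 + 1) lerD2l.
    rewrite (le_trans (normc_sum _ _ _))//.
    apply: (@le_trans _ _ (\sum_(k < N.+1) (c * s) ^+ k.+1)).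
      apply: ler_sum => k _; rewrite Normc.normcM normcX Normc.normcM normc_nat exprMn.
      apply: ler_pM; [by rewrite mulr_ge0 ?normc_ge0|exact/exprn_ge0/normc_ge0|exact: uc|].
      by rewrite lerXn2r ?nnegrE ?normc_ge0 ?(ltW s0) ?vs.
    by rewrite (le_trans (geometric1_le _ cs2))//; move: cs2; lra.
  pose Q := \sum_(i < N.+1) a i x * v x ^+ i.+2.
  have -> : P * v' + \sum_(k < N.+1) - transport_coef (a ^~ x) (u ^~ x) k * v x ^+ k.+2 =
      P * (v' - Q) + transport_rest (a ^~ x) (u ^~ x) N.+1 (v x).
    by rewrite -hE /P /Q; ring.
  rewrite (le_trans (le_normcD _ _))// /M [leRHS]mulrDl lerD// Normc.normcM.
  have -> : 4 * (s * (c * s) ^+ N.+2) = 2 * (2 * s * (c * s) ^+ N.+2) by ring.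
  apply: ler_pM; rewrite ?normc_ge0// (le_trans hV)//.
  rewrite (ler_wpM2l (ltW (mulr_gt0 (ltr0Sn R 1) s0)))//.
  apply: lerXn2r; rewrite ?nnegrE ?(ltW (mulr_gt0 l0 s0)) ?(ltW (mulr_gt0 c0 s0))//.
  by rewrite (ler_wpM2r (ltW s0)).
have F0 : F 0 = rho%:C.
  by rewrite /F v0 big1 ?addr0// => k _; rewrite u0// mul0r.
have FT : F T = rho%:C + u N T * rho%:C ^+ N.+2.
  rewrite /F vT big_ord_recr/= big1 ?add0r// => k _.
  by rewrite uT// mul0r.
move: hF; rewrite F0 FT addrAC subrr add0r subr0 Normc.normcM normcX nr => hF.
have rN : 0 < rho ^+ N.+2 by rewrite exprn_gt0.
rewrite -(ler_pM2r rN) (le_trans hF)// /M /C /s !exprMn.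
by rewrite le_eqVlt; apply/orP; left; apply/eqP; ring.
Qed.

Lemma monodromy_coef_eq0 : in_center_set a -> u N T = 0.
Proof.
move=> [e e0 ae].
have T0 := @two_pi_gt0 R.
have c0 : 0 < c by rewrite mulr_gt0//; lra.
have C0 : 0 <= C.
  have ec : 0 <= (2 * c) ^+ N.+2 by rewrite exprn_ge0// ltW// mulr_gt0.
  have eN : 0 <= 4 + N.+1%:R ^+ 2 :> R by rewrite addr_ge0// sqr_ge0.
  exact: mulr_ge0 (mulr_ge0 (mulr_ge0 eN (ler0n R 2)) ec) (ltW T0).
apply: Normc.eq0_normc; apply/eqP; rewrite eq_le normc_ge0 andbT.
apply/ler_addgt0Pr => h h0; rewrite add0r.
(* The four bounds respectively put [rho] in the range of the center property, make [C * rho] at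
   most [h], and give the two smallness conditions of [monodromy_coef_le]. *)
pose rho := Num.min (Num.min (e / 2) (h / (C + 1))) (Num.min (16 * c)^-1 (16 * l * T)^-1).
have lT : 0 < 16 * l * T by rewrite !mulr_gt0.
have rho0 : 0 < rho.
  by rewrite !lt_min !divr_gt0 ?invr_gt0 ?ltr_wpDl// mulr_gt0.
have r1 : rho <= e / 2 by rewrite !ge_min lexx.
have r2 : rho <= h / (C + 1) by rewrite !ge_min lexx ?orbT.
have r3 : rho <= (16 * c)^-1 by rewrite !ge_min lexx ?orbT.
have r4 : rho <= (16 * l * T)^-1 by rewrite !ge_min lexx ?orbT.
have [v vsol vT] : exists2 v, is_solution a rho%:C v & v (pi *+ 2) = rho%:C.
  by apply: ae; rewrite normc_real gtr0_norm//; lra.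
have := @monodromy_coef_le rho v rho0 _ _ vsol vT => hu.
rewrite (le_trans (hu _ _))//.
- by move: r3; rewrite -div1r ler_pdivlMr ?mulr_gt0//; lra.
- by move: r4; rewrite -div1r ler_pdivlMr//; lra.
- rewrite (le_trans (ler_wpM2l C0 r2))// mulrA ler_pdivrMr ?ltr_wpDl//; lra.
Qed.

End Monodromy.
End Necessity.

Section StrongChoice.

(** Each choice may depend on all earlier values, as the recursion for [u n] does. The first
    hypothesis says that [P s n] sees [s] only below [n], so the finite table [pre n], padded with
    [t0], can stand for the whole sequence. *)
Lemma strong_dependent_choice (T : Type) (t0 : T) (P : (nat -> T) -> nat -> T -> Prop) :
  (forall s s' n y, (forall k, (k < n)%N -> s k = s' k) -> P s n y -> P s' n y) ->
  (forall n s, (forall k, (k < n)%N -> P s k (s k)) -> exists y, P s n y) ->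
  exists s, forall n, P s n (s n).
Proof.
move=> Pext Pstep.
pose next s n := if pselect (exists y, P s n y) is left e then sval (cid e) else t0.
pose pre := fix pre n := if n is m.+1 then
  (fun k => if k == m then next (pre m) m else pre m k) else fun=> t0.
pose s n := next (pre n) n.
have preE n k : (k < n)%N -> pre n k = s k.
  elim: n => // n IH; rewrite ltnS leq_eqVlt => /predU1P[->|kn] /=; first by rewrite eqxx.
  by rewrite ltn_eqF// IH.
exists s; elim/ltn_ind => n IH.
have e : exists y, P (pre n) n y.
  apply: Pstep => k kn; rewrite preE//; apply: Pext (IH k kn) => j jk.
  by rewrite preE// (ltn_trans jk).
apply: (Pext (pre n)) => [k kn|]; first exact: preE.
by rewrite /s /next; case: pselect => // e'; case: cid.
Qed.

End StrongChoice.

(** * Construction of the periodic coefficients *)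

Section FirstIntegralOfCenter.
Context {R : realType}.
Local Notation mu := (@lebesgue_measure R).
Local Notation normc := (@Normc.normc R).
Local Notation T := (pi *+ 2 : R).

Lemma eq_transport_coef (K : comNzRingType) (a u u' : nat -> K) n :
  (forall k, (k < n)%N -> u k = u' k) -> transport_coef a u n = transport_coef a u' n.
Proof. by move=> uu'; congr (_ + _); apply: eq_bigr => k _; rewrite uu'. Qed.

Lemma is_deriveC_shift (f : R -> R[i]) (x t : R) d :
  is_deriveC f (x + t) d -> is_deriveC (fun y => f (y + t)) x d.
Proof.
have sh : is_derive x 1 (fun y : R => y + t) 1.
  by apply: is_derive_eq; rewrite addr0.
move=> [f1 f2]; split.
  have := @is_derive1_comp _ (fun y => complex.Re (f y)) (+%R^~ t) x _ _ f1 sh.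
  by rewrite mulr1.
have := @is_derive1_comp _ (fun y => complex.Im (f y)) (+%R^~ t) x _ _ f2 sh.
by rewrite mulr1.
Qed.

(** The difference [y (x + T) - y x] is Lipschitz with derivative 0 almost everywhere, hence
    constant, and it vanishes at 0. *)
Lemma periodic_primitive (f y : R -> R[i]) : (forall x, f (x + T) = f x) ->
  lipschitzC setT y -> y 0 = 0 -> y T = 0 ->
  {ae mu, forall x, is_deriveC y x (f x)} -> forall x, y (x + T) = y x.
Proof.
move=> fT [K yK] y0 yT y'.
pose z x := y (x + T) - y x.
have zL : lipschitzC setT z.
  exists (K + K) => s t _ _; rewrite /z.
  have -> : y (s + T) - y s - (y (t + T) - y t) =
    (y (s + T) - y (t + T)) - (y s - y t) by ring.
  rewrite (le_trans (le_normcB _ _))// mulrDl lerD ?yK//.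
  by have := yK (s + T) (t + T) I I; rewrite opprD addrACA subrr addr0.
have z' : {ae mu, forall x, is_deriveC z x 0}.
  apply: ae_mono2 y' (ae_shift T y') => x d1 /is_deriveC_shift; rewrite fT => d2.
  have dN : is_deriveC (fun t => - 1 * y t) x (- f x).
    apply: is_deriveC_eq (is_deriveCM (is_deriveC_cst (-1) x) d1) _.
    by rewrite mul0r add0r mulN1r.
  have := is_deriveCD d2 dN; rewrite subrr.
  by under eq_fun do rewrite mulN1r.
have zc p q : p <= q -> z q = z p.
  move=> pq; apply/eqP; rewrite -subr_eq0; apply/eqP/Normc.eq0_normc/eqP.
  rewrite eq_le normc_ge0 andbT -(mul0r (q - p)); apply: normc_increment_leM => //.
    exact: (lipschitzCS (fun _ _ => I) zL).
  by apply: ae_mono z' => x zx _; exists 0 => //; rewrite Normc.normc0.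
have z0 : z 0 = 0 by rewrite /z add0r yT y0 subrr.
move=> x; apply/eqP; rewrite -subr_eq0 -/(z x).
by have [x0|/ltW x0] := leP x 0; [rewrite -(zc _ _ x0)|rewrite (zc _ _ x0)]; rewrite z0.
Qed.

Lemma first_integral_of_center (a : nat -> R -> R[i]) : in_X a -> in_center_set a ->
  exists u : nat -> R -> R[i],
  [/\ forall k x, u k (x + T) = u k x, forall k, lipschitzC setT (u k),
      forall k, u k 0 = 0 & forall k, {ae mu, forall x,
        is_deriveC (u k) x (- transport_coef (a ^~ x) (u ^~ x) k)}].
Proof.
move=> aX ac; have [l l0 al] := in_X_ae_bound aX.
pose P (u : nat -> R -> R[i]) n y := [/\ forall x, y (x + T) = y x, lipschitzC setT y,
  y 0 = 0 & {ae mu, forall x, is_deriveC y x (- transport_coef (a ^~ x) (u ^~ x) n)}].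
suff [u uP] : exists u, forall n, P u n (u n).
  by exists u; split=> k; case: (uP k).
apply: strong_dependent_choice; first exact: (fun=> 0).
  move=> u u' n y uu' [y1 y2 y3 y4]; split => //; apply: ae_mono y4 => x.
  by rewrite (@eq_transport_coef _ _ (u ^~ x) (u' ^~ x))// => k kn; rewrite uu'.
move=> n u uP.
pose f x := - transport_coef (a ^~ x) (u ^~ x) n.
have am i : measurableC (a i) by case: (aX.1 i).
have aT i x : a i (x + T) = a i x by case: (aX.1 i) => + _ _ _; apply.
have uL k : (k < n)%N -> lipschitzC setT (u k) by move=> /uP[].
have uT k : (k < n)%N -> forall x, u k (x + T) = u k x by move=> /uP[].
have u0 k : (k < n)%N -> u k 0 = 0 by move=> /uP[].
have u' k : (k < n)%N ->
  {ae mu, forall x, is_deriveC (u k) x (- transport_coef (a ^~ x) (u ^~ x) k)} by move=> /uP[].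
have [fm1 fm2] : measurableC f.
  have -> : f = fun x => - 1 * (a n x + \sum_(k < n) k.+2%:R * u k x * a (n.-1 - k)%N x).
    by apply/funext => x; rewrite mulN1r.
  apply: measurableCM; first exact: measurableC_cst.
  apply: measurableCD => //.
  apply: (@measurableC_sum _ n (fun k x => k.+2%:R * u k x * a (n.-1 - k)%N x)) => k kn.
  apply: measurableCM => //; apply: measurableCM; first exact: measurableC_cst.
  exact/lipschitzC_measurable/uL.
have fT x : f (x + T) = f x.
  rewrite /f /transport_coef aT; congr (- (_ + _)).
  by apply: eq_bigr => k _; rewrite uT// aT.
have [|y [yL y0 y']] := @primitiveC _ f ((l * (2 + 4 * T)) ^+ n.+1) fm1 fm2.
  have := ae_periodic_coef_bound l0 al uT uL u0 u' (leqnn n).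
  by apply: ae_mono => x; rewrite normcN.
(* The candidate [y] is placed in slot [n] so that the monodromy lemma applies to it; that lemma
   asks for vanishing at [T] only of the earlier functions. *)
pose w k := if (k < n)%N then u k else y.
have wE k : (k < n)%N -> w k = u k by rewrite /w => ->.
have wn : w n = y by rewrite /w ltnn.
have yT : y T = 0.
  rewrite -wn; apply: (@monodromy_coef_eq0 _ a w l n l0 al) => //.
  - by move=> k; rewrite ltnS leq_eqVlt => /predU1P[->|kn]; rewrite ?wn ?wE//; exact: uL.
  - by move=> k; rewrite ltnS leq_eqVlt => /predU1P[->|kn]; rewrite ?wn ?wE//; exact: u0.
  - move=> k kn; have {}kn : (k <= n)%N by rewrite -ltnS.
    have e x : transport_coef (a ^~ x) (w ^~ x) k = transport_coef (a ^~ x) (u ^~ x) k.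
      by apply: eq_transport_coef => j jk; rewrite wE// (leq_trans jk).
    have wk : {ae mu, forall x, is_deriveC (w k) x (- transport_coef (a ^~ x) (u ^~ x) k)}.
      by move: kn; rewrite leq_eqVlt => /predU1P[->|kn]; [rewrite wn|rewrite wE//; exact: u'].
    by apply: ae_mono wk => x; rewrite e.
  - by move=> k kn; rewrite wE// -[T]add0r uT// u0.
by exists y; split => //; exact: periodic_primitive fT yL y0 yT y'.
Qed.

End FirstIntegralOfCenter.

Unset Implicit Arguments.

Theorem theorem2p4 (R : realType) (a : nat -> R -> R[i]) (aX : in_X a) :
  in_center_set a <->
  exists u : nat -> R -> R[i],
    [/\ forall k, periodic (u k) (pi *+ 2) /\ lipschitzC setT (u k),
        forall k, u k 0 = 0 &
        forall n, {ae @lebesgue_measure R, forall x,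
          equation_series a x n =
          fps_opp (fps_div (numerator_series u x) (denominator_series u x)) n}].
Proof.
split=> [ac|[u [uP u0 us]]]; last exact: center_of_first_integral uP u0 us.
have [u [uT uL u0 u']] := first_integral_of_center aX ac.
exists u; split => // [k|n]; first by split; [exact: uT|exact: uL].
apply: ae_mono (ae_foralln u') => x ux.
apply: (series_transportP a u x).2 => k.
exact: (is_deriveC_deriveC (ux k)).2.
Qed.
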